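(* Let $u_1,\dots,u_4$ be a positive orthonormal basis of an oriented Euclidean four-space $\mathcal{T}$. For $\mathrm{s},\lambda,\xi\in\mathbb{R}$, let $R$ be the algebraic curvature tensor in $\mathcal{T}$ with scalar curvature $\mathrm{s}$, with Einstein tensor $\mathrm{e}$ diagonalized by $u_1,u_2,u_3,u_4$ with the respective eigenvalues $(-\lambda,-\lambda,\lambda,\lambda)$, and such that, for each sign $\pm$, the basis $u_1\wedge u_2\pm u_3\wedge u_4,\ u_1\wedge u_3\pm u_4\wedge u_2,\ u_1\wedge u_4\pm u_2\wedge u_3$ of $\Lambda^\pm$ diagonalizes $W^\pm:\Lambda^\pm\to\Lambda^\pm$, with the respective eigenvalues $(\mathrm{s}/6,-\mathrm{s}/12,-\mathrm{s}/12)$ for $W^+$ and $(-\mathrm{s}/3,\ 2\xi-\mathrm{s}/12,\ -2\xi+5\mathrm{s}/12)$ for $W^-$. Then $R$ is a Kähler-type weakly Einstein algebraic curvature tensor. Conversely, for every non-Einstein Kähler-type weakly Einstein algebraic curvature tensor in an oriented Euclidean four-space there exist a positive orthonormal basis $u_1,\dots,u_4$ of the four-space, $\mathrm{s},\xi\in\mathbb{R}$ and $\lambda>0$ such that its scalar curvature is $\mathrm{s}$, its Einstein tensor $\mathrm{e}$ is diagonalized by $u_1,u_2,u_3,u_4$ with the respective eigenvalues $(-\lambda,-\lambda,\lambda,\lambda)$ and, for each sign $\pm$, the basis $u_1\wedge u_2\pm u_3\wedge u_4,\ u_1\wedge u_3\pm u_4\wedge u_2,\ u_1\wedge u_4\pm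 u_2\wedge u_3$ of $\Lambda^\pm$ diagonalizes its $W^\pm$, with the respective eigenvalues $(\mathrm{s}/6,-\mathrm{s}/12,-\mathrm{s}/12)$ for $W^+$ and $(-\mathrm{s}/3,\ 2\xi-\mathrm{s}/12,\ -2\xi+5\mathrm{s}/12)$ for $W^-$. Rather than prescribing that, for each sign $\pm$, the basis $u_1\wedge u_2\pm u_3\wedge u_4,\ u_1\wedge u_3\pm u_4\wedge u_2,\ u_1\wedge u_4\pm u_2\wedge u_3$ of $\Lambda^\pm$ diagonalize $W^\pm$ with the respective eigenvalues $(\mathrm{s}/6,-\mathrm{s}/12,-\mathrm{s}/12)$ for $W^+$ and $(-\mathrm{s}/3,\ 2\xi-\mathrm{s}/12,\ -2\xi+5\mathrm{s}/12)$ for $W^-$, one can equivalently require that the only possibly-nonzero components of $W$ in the frame $u_1,\dots,u_4$ be those algebraically related to the ones in the ordered triples $(W_{1212},W_{1313},W_{1414})=(W_{3434},W_{2424},W_{2323})=(-\mathrm{s}/12,\ \xi-\mathrm{s}/12,\ -\xi+\mathrm{s}/6)$ and $(W_{1234},W_{1342},W_{1423})=(\mathrm{s}/4,\ -\xi,\ \xi-\mathrm{s}/4)$.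
   Context: $\mathcal{T}$ is an oriented Euclidean four-space with inner product $\mathrm{g}$. An algebraic curvature tensor $R$ in $\mathcal{T}$ is a $(0,4)$ tensor with $R_{ijkl}=-R_{jikl}=-R_{ijlk}=R_{klij}$ and $R_{ijkl}+R_{jkil}+R_{kijl}=0$. In an orthonormal basis, the Ricci tensor is $\mathrm{r}_{ij}=\sum_k R_{ikjk}$, the scalar curvature is $\mathrm{s}=\sum_i \mathrm{r}_{ii}$, the Einstein (traceless Ricci) tensor is $\mathrm{e}=\mathrm{r}-\mathrm{s}\,\mathrm{g}/4$, and the Weyl component is $W_{ijkl}=R_{ijkl}-\frac12(\mathrm{g}_{ik}\mathrm{r}_{jl}+\mathrm{g}_{jl}\mathrm{r}_{ik}-\mathrm{g}_{il}\mathrm{r}_{jk}-\mathrm{g}_{jk}\mathrm{r}_{il})+\frac{\mathrm{s}}6(\mathrm{g}_{ik}\mathrm{g}_{jl}-\mathrm{g}_{il}\mathrm{g}_{jk})$. $R$ is called weakly Einstein if the symmetric tensor with components $\sum_{k,p,q}R_{ikpq}R_{jkpq}$ (in an orthonormal basis) is a multiple of $\mathrm{g}$, and Einstein if $\mathrm{e}=0$. Eigenvalues of $\mathrm{e}$ are taken relative to $\mathrm{g}$. $\Lambda^\pm\subset\mathcal{T}^{\wedge2}$ are the three-dimensional spaces of self-dual and anti-self-dual bivectors; $W$ acts on bivectors $b$ by $[Wb]_{ij}=\sum_{p,q}W_{ipjq}b_{pq}=\frac12\sum_{p,q}W_{ijpq}b_{pq}$, this action preserves $\Lambda^\pm$,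 and $W^\pm:\Lambda^\pm\to\Lambda^\pm$ denote its restrictions. By the Singer-Thorpe theorem, prescribing $\mathrm{s}\in\mathbb{R}$, a $\mathrm{g}$-traceless symmetric tensor $\mathrm{e}$ and traceless self-adjoint $W^\pm:\Lambda^\pm\to\Lambda^\pm$ defines a unique algebraic curvature tensor $R$. Components of $W$ ''algebraically related'' to given ones are those obtained from them via the symmetries $W_{ijkl}=-W_{jikl}=-W_{ijlk}=W_{klij}$. An algebraic curvature tensor $R$ in $\mathcal{T}$ is of Kähler type if there is a positive orthonormal basis $u_1,\dots,u_4$ of $\mathcal{T}$ diagonalizing $\mathrm{e}$ with respective eigenvalues $\mu_1,\mu_2,\mu_3,\mu_4$ such that $\mu_1=\mu_2$ and $\mu_3=\mu_4$, while the basis $u_1\wedge u_2+u_3\wedge u_4,\ u_1\wedge u_3+u_4\wedge u_2,\ u_1\wedge u_4+u_2\wedge u_3$ of $\Lambda^+$ diagonalizes $W^+$ with the respective eigenvalues $(\mathrm{s}/6,-\mathrm{s}/12,-\mathrm{s}/12)$. *)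

(* Defs.v *)
From HB Require Import structures.
From mathcomp Require Import all_boot all_order all_algebra.
From mathcomp Require Import sesquilinear reals.

Set Implicit Arguments.
Unset Strict Implicit.
Unset Printing Implicit Defensive.
Import Order.TTheory GRing.Theory Num.Theory.
Local Open Scope ring_scope.

(* The orientation is the class of bases having a positive change-of-basis
   determinant with respect to [orient]; dimension four follows from
   [orient_basis]. *)
Record oriented_euclidean4 (R : realType) := OrientedEuclidean4 {
  carrier :> vectType R;
  inner : {dot carrier for idfun};
  orient : 4.-tuple carrier;
  orient_basis : basis_of fullv orient }.

Section OrientedEuclidean4.
Context {R : realType} {T : oriented_euclidean4 R}.

Local Notation g := (inner T).

Definition posonb (u : 4.-tuple T) : bool :=
  orthonormal g u && (0 < \det (\matrix_(i < 4, j < 4) coord (orient T) j u`_i)).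

Let dotC x y : g x y = g y x. Proof. by rewrite hermC expr0 mul1r. Qed.

Lemma orthonormalP_nth (s : seq T) (i j : nat) : orthonormal g s ->
  (i < size s)%N -> (j < size s)%N -> g s`_i s`_j = (i == j)%:R.
Proof.
elim: s i j => [|x s IHs] //= i j.
rewrite /orthonormal /= => /andP[/andP[/eqP x1 s1] /andP[]].
rewrite andbT => /allP xs os; have {}IHs := IHs _ _ (introT andP (conj s1 os)).
have x0 k : (k < size s)%N -> g x s`_k = 0 by move=> /(mem_nth 0)/xs /eqP.
case: i j => [|i] [|j] //= si sj; rewrite ?x0 ?IHs //.
by rewrite dotC x0.
Qed.

Lemma orthonormal_seq_exists n : (n <= 4)%N ->
  exists s : seq T, [/\ size s = n, orthonormal g s &
    exists2 V : {vspace T}, (4 - n <= \dim V)%N & {in s & V, forall x y, g x y = 0}].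
Proof.
elim: n => [_|n IHn ltn4].
  exists [::]; split=> //; exists fullv => //.
  by rewrite -(span_basis (orient_basis T)) (eqP (basis_free (orient_basis T))) size_tuple.
have [s [sz_s /andP[s1 os] [V dimV sV]]] := IHn (ltnW ltn4).
have V0 : (0 < \dim V)%N by apply: leq_trans dimV; rewrite subn_gt0.
pose v := vpick V; have gv : 0 < g v v.
  by rewrite neq0_dnorm_gt0 // vpick0 -dimv_eq0 -lt0n.
pose u := (Num.sqrt (g v v))^-1 *: v.
have uV : u \in V by rewrite rpredZ // memv_pick.
have u1 : g u u = 1.
  rewrite linearZl_LR linearZr_LR /= mulrA -invfM -expr2 sqr_sqrtr ?ltW //.
  by rewrite mulVf ?gt_eqF.
exists (u :: s); split; first by rewrite /= sz_s.
  rewrite /orthonormal /= u1 eqxx s1 os !andbT /=.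
  by apply/allP => x xs /=; rewrite dotC sV.
exists (V :&: orthov g <[u]>)%VS.
  apply: leq_trans (leq_dim_orthov1 g u V).
  by rewrite subnS -!subn1 leq_sub2r.
move=> x y; rewrite in_cons memv_cap => /predU1P[->|xs] /andP[yV yu].
  by rewrite dotC; apply/eqP; rewrite -mem_orthov1.
exact: sV.
Qed.

Let coord_mx (u : seq T) : 'M[R]_4 := \matrix_(i, j) coord (orient T) j u`_i.

Lemma posonb_exists : exists u : 4.-tuple T, posonb u.
Proof.
have [s [sz_s on_s _]] := orthonormal_seq_exists (leqnn 4).
have dets0 : \det (coord_mx s) != 0.
  pose G : 'M[R]_4 := \matrix_(i, j) g (orient T)`_i (orient T)`_j.
  have sE x : x = \sum_l coord (orient T) l x *: (orient T)`_l.
    by rewrite -coord_span // (span_basis (orient_basis T)) memvf.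
  have sGs : coord_mx s *m (G *m (coord_mx s)^T) = 1%:M.
    apply/matrixP => i j; rewrite !mxE.
    rewrite -val_eqE -(orthonormalP_nth on_s) ?sz_s ?ltn_ord // [in RHS](sE s`_i) linear_sumlz.
    apply: eq_bigr => k _; rewrite linearZl_LR /= [in RHS](sE s`_j) linear_sumr !mxE.
    by congr (_ * _); apply: eq_bigr => l _; rewrite !mxE linearZr_LR /= mulrC.
  apply/eqP => s0; move/(congr1 determinant)/eqP: sGs.
  by rewrite det_mulmx s0 mul0r det1 eq_sym oner_eq0.
have [dets|] := ltP 0 (\det (coord_mx s)).
  by exists (Tuple (introT eqP sz_s)); rewrite /posonb on_s.
rewrite le_eqVlt (negPf dets0) /= => dets.
case: s sz_s on_s dets {dets0} => [|x s] //= [sz_s] on_s dets.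
exists (Tuple (introT eqP (congr1 S sz_s) : size (- x :: s) == 4)); rewrite /posonb /=.
apply/andP; split.
  move: on_s; rewrite /orthonormal /= hnormN !andbT => /andP[-> /andP[/allP xs ->]].
  by rewrite andbT; apply/allP => y /xs /=; rewrite linearNl oppr_eq0.
set M := \matrix_(_, _) _.
have -> : M = diag_mx (\row_i (-1) ^+ (i == 0)) *m coord_mx (x :: s).
  apply/matrixP => i j; rewrite mul_diag_mx !mxE.
  by case: (unliftP 0 i) => [k|] -> /=; rewrite ?mul1r // linearN mulN1r.
rewrite det_mulmx det_diag big_ord_recl big1 => [|i _]; rewrite !mxE //=.
by rewrite mulr1 mulN1r oppr_gt0.
Qed.

(* A positive orthonormal basis, used to contract tensors and to represent
   bivectors by their components; the notions for curvature tensors below do not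
   depend on which one is chosen. *)
Definition frame : 4.-tuple T := xchoose posonb_exists.

Lemma frameP : posonb frame. Proof. exact: xchooseP. Qed.

Local Notation e := frame.

Implicit Types (Rm : T -> T -> T -> T -> R) (u : 4.-tuple T) (b : 'M[R]_4).

Record curvature_tensor Rm : Prop := CurvatureTensor {
  curv_linear1 : forall y z w, scalar (fun x => Rm x y z w);
  curv_linear2 : forall x z w, scalar (fun y => Rm x y z w);
  curv_linear3 : forall x y w, scalar (fun z => Rm x y z w);
  curv_linear4 : forall x y z, scalar (fun w => Rm x y z w);
  curv_skew12 : forall x y z w, Rm x y z w = - Rm y x z w;
  curv_skew34 : forall x y z w, Rm x y z w = - Rm x y w z;
  curv_pairs : forall x y z w, Rm x y z w = Rm z w x y;
  curv_bianchi : forall x y z w, Rm x y z w + Rm y z x w + Rm z x y w = 0 }.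

Definition ricci Rm (x y : T) : R := \sum_(k < 4) Rm x e`_k y e`_k.

Definition scal Rm : R := \sum_(i < 4) ricci Rm e`_i e`_i.

Definition einstein_tensor Rm (x y : T) : R :=
  ricci Rm x y - scal Rm * g x y / 4.

Definition weyl Rm (x y z w : T) : R :=
  Rm x y z w
  - 2^-1 * (g x z * ricci Rm y w + g y w * ricci Rm x z
            - g x w * ricci Rm y z - g y z * ricci Rm x w)
  + scal Rm / 6 * (g x z * g y w - g x w * g y z).

Definition einstein Rm : Prop := forall x y : T, einstein_tensor Rm x y = 0.

Definition weakly_einstein Rm : Prop := exists c : R, forall x y : T,
  \sum_(k < 4) \sum_(p < 4) \sum_(q < 4)
     Rm x e`_k e`_p e`_q * Rm y e`_k e`_p e`_q = c * g x y.

Definition einstein_diag Rm u (mu : seq R) : Prop :=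
  forall (i : 'I_4) (y : T), einstein_tensor Rm u`_i y = mu`_i * g u`_i y.

(* A bivector b is represented by the skew-symmetric matrix of its components
   in [frame]. *)
Definition wedge (x y : T) : 'M[R]_4 :=
  \matrix_(i < 4, j < 4) (g x e`_i * g y e`_j - g y e`_i * g x e`_j).

Definition weyl_op Rm b : 'M[R]_4 :=
  \matrix_(i < 4, j < 4)
    (2^-1 * \sum_(p < 4) \sum_(q < 4) weyl Rm e`_i e`_j e`_p e`_q * b p q).

Definition levi_civita (i j p q : 'I_4) : R :=
  \det (\matrix_(a < 4, c < 4) (tnth [tuple i; j; p; q] a == c)%:R).

Definition hodge b : 'M[R]_4 :=
  \matrix_(i < 4, j < 4)
    (2^-1 * \sum_(p < 4) \sum_(q < 4) levi_civita i j p q * b p q).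

(* Self-dual bivectors for eps = 1, anti-self-dual ones for eps = -1. *)
Definition Lambda (eps : R) : {vspace 'M[R]_4} :=
  (lker (linfun (fun b => (b^T + b)%R)) :&:
   lker (linfun (fun b => (hodge b - eps *: b)%R)))%VS.

Lemma mem_Lambda (eps : R) b :
  reflect (b^T = - b /\ hodge b = eps *: b) (b \in Lambda eps).
Proof.
have lin1 : linear (fun b : 'M[R]_4 => b^T + b).
  by move=> a c d; rewrite linearP /= scalerDr addrACA.
have lin2 : linear (fun b => hodge b - eps *: b).
  move=> a c d; rewrite scalerBr addrACA -opprD !scalerA [a * eps]mulrC.
  rewrite -scalerA -scalerDr; congr (_ - _); apply/matrixP => i j; rewrite !mxE.
  rewrite [a * _]mulrCA -mulrDr [a * _]big_distrr -big_split /=; congr (_ * _).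
  apply: eq_bigr => p _; rewrite [a * _]big_distrr -big_split /=.
  by apply: eq_bigr => q _; rewrite !mxE mulrDr mulrCA.
pose f1 := GRing.isLinear.Build _ _ _ _ _ lin1.
pose f2 := GRing.isLinear.Build _ _ _ _ _ lin2.
pose F1 : {linear 'M[R]_4 -> 'M[R]_4} := HB.pack (fun b : 'M[R]_4 => b^T + b) f1.
pose F2 : {linear 'M[R]_4 -> 'M[R]_4} := HB.pack (fun b => hodge b - eps *: b) f2.
rewrite memv_cap !memv_ker (lfunE F1) (lfunE F2) /= addr_eq0 subr_eq0.
by apply: (iffP andP) => -[/eqP ? /eqP ?].
Qed.

Definition diagonalizes n (V : {vspace 'M[R]_4}) (f : 'M[R]_4 -> 'M[R]_4)
    (X : n.-tuple 'M[R]_4) (a : seq R) : Prop :=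
  basis_of V X /\ forall i : 'I_n, f X`_i = a`_i *: X`_i.

Definition duality_basis (eps : R) u : 3.-tuple 'M[R]_4 :=
  [tuple wedge u`_0 u`_1 + eps *: wedge u`_2 u`_3;
         wedge u`_0 u`_2 + eps *: wedge u`_3 u`_1;
         wedge u`_0 u`_3 + eps *: wedge u`_1 u`_2].

(* W^+ (eps = 1) and W^- (eps = -1) are the restrictions of [weyl_op] to
   [Lambda eps]. *)
Definition weyl_diag (eps : R) Rm u (a : seq R) : Prop :=
  diagonalizes (Lambda eps) (weyl_op Rm) (duality_basis eps u) a.

Definition kaehler_type Rm : Prop :=
  exists (u : 4.-tuple T) (mu1 mu2 mu3 mu4 : R),
    [/\ posonb u, einstein_diag Rm u [:: mu1; mu2; mu3; mu4],
        mu1 = mu2, mu3 = mu4 &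
        weyl_diag 1 Rm u [:: scal Rm / 6; - (scal Rm / 12); - (scal Rm / 12)]].

Definition weyl_pm_spectrum Rm u (s xi : R) : Prop :=
  weyl_diag 1 Rm u [:: s / 6; - (s / 12); - (s / 12)] /\
  weyl_diag (-1) Rm u
    [:: - (s / 3); 2 * xi - s / 12; - (2 * xi) + 5 * s / 12].

(* Vectors of a basis are numbered from 0, so u_1, ..., u_4 are
   u`_0, ..., u`_3 and W_1342 is the component (0, 2, 3, 1). *)
Definition weyl_comp Rm u (i : nat * nat * nat * nat) : R :=
  let: (i1, i2, i3, i4) := i in weyl Rm u`_i1 u`_i2 u`_i3 u`_i4.

(* The orbit under the symmetries W_ijkl = -W_jikl = -W_ijlk = W_klij. *)
Definition alg_related (i j : nat * nat * nat * nat) : bool :=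
  let: (i1, i2, i3, i4) := i in
  j \in [:: (i1, i2, i3, i4); (i2, i1, i3, i4); (i1, i2, i4, i3); (i2, i1, i4, i3);
            (i3, i4, i1, i2); (i4, i3, i1, i2); (i3, i4, i2, i1); (i4, i3, i2, i1)].

Definition weyl_components Rm u (s xi : R) : Prop :=
  let listed : seq (nat * nat * nat * nat) :=
    [:: (0, 1, 0, 1); (0, 2, 0, 2); (0, 3, 0, 3);
        (2, 3, 2, 3); (1, 3, 1, 3); (1, 2, 1, 2);
        (0, 1, 2, 3); (0, 2, 3, 1); (0, 3, 1, 2)]%N in
  let W := weyl_comp Rm u in
  [/\ (W (0, 1, 0, 1), W (0, 2, 0, 2), W (0, 3, 0, 3))%N
        = (- (s / 12), xi - s / 12, - xi + s / 6),
      (W (2, 3, 2, 3), W (1, 3, 1, 3), W (1, 2, 1, 2))%N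
        = (- (s / 12), xi - s / 12, - xi + s / 6),
      (W (0, 1, 2, 3), W (0, 2, 3, 1), W (0, 3, 1, 2))%N
        = (s / 4, - xi, xi - s / 4) &
      forall i j k l : 'I_4,
        ~~ has (fun m => alg_related m (val i, val j, val k, val l)) listed ->
        W (val i, val j, val k, val l) = 0].

End OrientedEuclidean4.

(* Main.v *)
Require Import Defs.
From HB Require Import structures.
From mathcomp Require Import all_boot all_order all_algebra.
From mathcomp Require Import sesquilinear reals.
From mathcomp Require Import ring lra.
Import Order.TTheory GRing.Theory Num.Theory.
Local Open Scope ring_scope.

Set Implicit Arguments.
Unset Strict Implicit.
Unset Printing Implicit Defensive.

(** A curvature tensor acts on bivectors, with diagonal blocks W^+ + s/12 and
    W^- + s/12 on the self-dual and anti-self-dual ones, and an off-diagonal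
    block given by the Einstein tensor. Let w^+_c and w^-_c, for c = 0, 1, 2, be
    the bases of the two spaces attached to a frame u_1, ..., u_4, that is
    w_0 = u_1 ^ u_2 +- u_3 ^ u_4, and so on. For a tensor of Kaehler type whose
    Einstein tensor has the eigenvalues (-lambda, -lambda, lambda, lambda), the
    self-dual block is diag(s/4, 0, 0), and the off-diagonal block exchanges
    w^+_0 and w^-_0 with the factor -lambda ([contract_curv]).

    The tensor with components sum R_ikpq R_jkpq is the sum of the products
    A A^T of the six skew matrices A obtained by pairing the last two indices of
    R with w^+_c and w^-_c ([skew_parseval]). Each of these matrices has the
    form a w^+_0 + sum_d b_d w^-_d. As 4 x 4 matrices, the w^+_c and the w^-_c
    are two commuting triples of quaternion units, so A A^T is a multiple of the
    identity plus a combination, with coefficients proportional to a b_d, of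
    the symmetric traceless products w^+_0 w^-_d ([omega_square]). Summing up,
    the tensor is a multiple of g exactly when lambda = 0 or w^-_0 is an
    eigenvector of W^- for the eigenvalue -s/3 ([weakly_einstein_kaehlerP]).
    This proves the direct half of the classification.

    Conversely, let the tensor be of Kaehler type, weakly Einstein and not
    Einstein. The Einstein tensor is traceless, so that its eigenvalues are
    (-lambda, -lambda, lambda, lambda) with lambda nonzero, and exchanging the
    planes (u_1, u_2) and (u_3, u_4) makes lambda positive
    ([kaehler_normal_frame]). Now w^-_0 is an eigenvector of W^-. A rotation of
    (u_3, u_4) fixes w^+_0 and w^-_0 and rotates (w^+_1, w^+_2) and
    (w^-_1, w^-_2); the first pair lies in an eigenspace of W^+, so the Kaehler
    form survives, while a suitable angle diagonalizes W^- on the second pair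
    ([diagonalize_weyl_minus]). The Bianchi identity makes the traces of W^+ and
    W^- equal, and tr W^+ = 0, so the two remaining eigenvalues add up to s/3;
    the parameter xi describes them.

    The description by components holds because a skew array is recovered from
    its pairings with the w^+_c and w^-_c ([skew_split]): the eigenvalues and the
    components of W determine each other ([weyl_componentsP]). Statements about
    the chosen frame are carried to any positive orthonormal frame by
    bilinearity ([contraction_frame], [bivectorP]), and the Hodge star by
    writing it with the volume form, which all these frames share
    ([hodge_wedge], [volume_frame]). *)

(** * Determinants of small matrices *)

Definition det3 (R : comNzRingType) (a : nat -> nat -> R) :=
    a 0 0 * (a 1 1 * a 2 2 - a 1 2 * a 2 1)
  - a 0 1 * (a 1 0 * a 2 2 - a 1 2 * a 2 0)
  + a 0 2 * (a 1 0 * a 2 1 - a 1 1 * a 2 0).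

Lemma det_mx22 (R : comNzRingType) (M : 'M[R]_2) :
  \det M = M ord0 ord0 * M ord_max ord_max - M ord0 ord_max * M ord_max ord0.
Proof.
rewrite (expand_det_row _ ord0) !big_ord_recl big_ord0 /cofactor !det_mx11 !mxE.
have -> : lift (0 : 'I_2) (0 : 'I_1) = ord_max by apply: val_inj.
have -> : lift (ord_max : 'I_2) (0 : 'I_1) = 0 by apply: val_inj.
by rewrite /= /bump /= !mul1r addr0 mulN1r mulrN.
Qed.

Lemma det_mx33 (R : comNzRingType) (a : nat -> nat -> R) :
  \det (\matrix_(i < 3, j < 3) a i j) = det3 a.
Proof.
rewrite (expand_det_row _ ord0) !big_ord_recl big_ord0 /cofactor.
rewrite !det_mx22 !mxE /= /bump /= /det3; ring.
Qed.

Definition det4 (R : comNzRingType) (a : nat -> nat -> R) :=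
  let minor k := det3 (fun i j => a i.+1 (bump k j)) in
  a 0 0 * minor 0%N - a 0 1 * minor 1%N + a 0 2 * minor 2%N - a 0 3 * minor 3%N.

Lemma det_mx44 (R : comNzRingType) (a : nat -> nat -> R) :
  \det (\matrix_(i < 4, j < 4) a i j) = det4 a.
Proof.
rewrite (expand_det_row _ ord0) !big_ord_recl big_ord0 /cofactor.
set minor := fun k => det3 (fun i j => a i.+1 (bump k j)).
have minorE (k : 'I_4) :
    \det (row' ord0 (col' k (\matrix_(i < 4, j < 4) a i j))) = minor k.
  rewrite /minor -(det_mx33 (fun i j => a i.+1 (bump k j))); congr (\det _).
  by apply/matrixP => i j; rewrite !mxE.
have -> : det4 a = a 0 0 * minor 0 - a 0 1 * minor 1 + a 0 2 * minor 2 - a 0 3 * minor 3.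
  by [].
rewrite !minorE !mxE /= /bump /=.
move: (minor _) (minor _) (minor _) (minor _) => m0 m1 m2 m3; ring.
Qed.

(** * Orthonormal frames *)

Section OrthonormalFrames.
Context {R : realType} {T : oriented_euclidean4 R}.
Local Notation g := (inner T).
Implicit Types (x y z w : T) (u v : 4.-tuple T).

Lemma innerC x y : g x y = g y x.
Proof. by rewrite hermC expr0 mul1r. Qed.

Lemma inner_frame u (i j : 'I_4) :
  orthonormal g u -> g u`_i u`_j = (i == j)%:R.
Proof. by move=> onu; rewrite (orthonormalP_nth onu) ?size_tuple. Qed.

Lemma inner_combination u (c : 'I_4 -> R) (i : 'I_4) : orthonormal g u ->
  g (\sum_j c j *: u`_j) u`_i = c i.
Proof.
move=> onu; rewrite linear_sumlz (bigD1 i) //= big1 => [|j ji].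
  by rewrite linearZl_LR /= inner_frame // eqxx mulr1 addr0.
by rewrite linearZl_LR /= inner_frame // (negPf ji) mulr0.
Qed.

(** Orthonormality makes [u] free, and the orientation basis shows that the
    dimension is four, so [u] is a basis and its coordinates are inner products. *)
Lemma frame_expansion u x :
  orthonormal g u -> x = \sum_(i < 4) g x u`_i *: u`_i.
Proof.
move=> onu.
have freeu : free u.
  apply/freeP => k k0 i; have := congr1 (g^~ u`_i) k0.
  by rewrite inner_combination // linear0l.
have basu : basis_of fullv u.
  rewrite basisEfree freeu subvf size_tuple.
  by rewrite -(span_basis (orient_basis T)) (leq_trans (dim_span _)) ?size_tuple.
rewrite [LHS](coord_basis basu (memvf x)); apply: eq_bigr => i _.
by rewrite {2}(coord_basis basu (memvf x)) inner_combination.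
Qed.

Lemma scalar_lincomb (f : T -> R) a b x y : scalar f ->
  f (a *: x + b *: y) = a * f x + b * f y.
Proof.
move=> linf; have f0 : f 0 = 0.
  by have := linf (-1) 0 0; rewrite scaler0 addr0 mulN1r addNr.
by rewrite linf; have := linf b y 0; rewrite !addr0 f0 addr0 => ->.
Qed.

Lemma scalar_sum (f : T -> R) n (c : 'I_n -> R) (v : 'I_n -> T) : scalar f ->
  f (\sum_i c i *: v i) = \sum_i c i * f (v i).
Proof.
move=> linf; have f0 : f 0 = 0.
  by have := scalar_lincomb 0 0 0 0 linf; rewrite !scale0r addr0 !mul0r addr0.
elim: n c v => [|n IHn] c v; first by rewrite !big_ord0.
by rewrite !big_ord_recl linf IHn.
Qed.

Lemma scalar_expansion u (f : T -> R) x : orthonormal g u -> scalar f ->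
  f x = \sum_(i < 4) g x u`_i * f u`_i.
Proof. by move=> onu linf; rewrite {1}(frame_expansion x onu) scalar_sum. Qed.

Definition bilinear_form (B : T -> T -> R) :=
  (forall y, scalar (B^~ y)) /\ (forall x, scalar (B x)).

Lemma bilinear_inner : bilinear_form g.
Proof.
by split=> [y a x z|x a y z]; rewrite ?linearPl ?linearPr.
Qed.

Lemma bilinear_eq u (B C : T -> T -> R) : orthonormal g u ->
  bilinear_form B -> bilinear_form C ->
  (forall i j : 'I_4, B u`_i u`_j = C u`_i u`_j) -> forall x y, B x y = C x y.
Proof.
move=> onu [Bl Br] [Cl Cr] BC x y.
rewrite (scalar_expansion x onu (Bl y)) (scalar_expansion x onu (Cl y)).
apply: eq_bigr => i _; congr (_ * _).
rewrite (scalar_expansion y onu (Br _)) (scalar_expansion y onu (Cr _)).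
by apply: eq_bigr => j _; rewrite BC.
Qed.

Lemma parseval u x y : orthonormal g u ->
  g x y = \sum_(i < 4) g x u`_i * g y u`_i.
Proof.
move=> onu; rewrite (scalar_expansion x onu (proj1 bilinear_inner y)).
by apply: eq_bigr => i _; rewrite [g u`_i y]innerC.
Qed.

(** Expand both arguments in [v]; summing over [u] first, Parseval turns the
    products of coefficients into Kronecker deltas. *)
Lemma contraction_frame u v (B : T -> T -> R) :
  orthonormal g u -> orthonormal g v -> bilinear_form B ->
  \sum_(k < 4) B u`_k u`_k = \sum_(k < 4) B v`_k v`_k.
Proof.
move=> onu onv [Bl Br].
transitivity (\sum_(k < 4) \sum_(i < 4) \sum_(j < 4)
    g u`_k v`_i * (g u`_k v`_j * B v`_i v`_j)).
  apply: eq_bigr => k _; rewrite (scalar_expansion _ onv (Bl _)).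
  apply: eq_bigr => i _; rewrite (scalar_expansion _ onv (Br _)).
  by rewrite mulr_sumr.
rewrite exchange_big /=; apply: eq_bigr => i _.
rewrite exchange_big /= (bigD1 i) //= [X in _ + X]big1 => [|j ji].
  under eq_bigr do rewrite mulrA.
  rewrite -mulr_suml addr0 -[RHS]mul1r; congr (_ * _).
  under eq_bigr do rewrite ![g u`_ _ _]innerC.
  by rewrite -parseval // inner_frame // eqxx.
under eq_bigr do rewrite mulrA.
rewrite -mulr_suml; under eq_bigr do rewrite ![g u`_ _ _]innerC.
by rewrite -parseval // inner_frame // eq_sym (negPf ji) mul0r.
Qed.

End OrthonormalFrames.

(** * The Hodge star of a wedge product *)

Section Duality.
Context {R : realType} {T : oriented_euclidean4 R}.
Local Notation g := (inner T).
Local Notation e := (@frame R T).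
Implicit Types (x y z w : T) (u v : 4.-tuple T).

Lemma posonb_orthonormal u : posonb u -> orthonormal g u.
Proof. by case/andP. Qed.

Lemma frame_orthonormal : orthonormal g e.
Proof. exact: posonb_orthonormal frameP. Qed.

Definition volume u x1 x2 x3 x4 : R :=
  \det (\matrix_(a < 4, c < 4) g [:: x1; x2; x3; x4]`_a u`_c).

(** The matrix is orthogonal, so its determinant is 1 or -1, and it relates two
    bases of the same orientation. *)
Lemma change_of_frame_det u : posonb u ->
  \det (\matrix_(a < 4, c < 4) g u`_a e`_c) = 1.
Proof.
move=> pu; have onu := posonb_orthonormal pu; set P := \matrix_(_, _) _.
have /andP[_ dete] := @frameP R T; have /andP[_ detu] := pu.
have detP : 0 < \det P.
  rewrite -(pmulr_lgt0 _ dete) -det_mulmx; apply: etrans detu; congr (0 < \det _).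
  apply/matrixP => i j; rewrite !mxE [in RHS](frame_expansion u`_i frame_orthonormal).
  by rewrite linear_sum; apply: eq_bigr => k _; rewrite !mxE linearZ.
have PPt : P *m P^T = 1%:M.
  apply/matrixP => i j; rewrite !mxE -(inner_frame _ _ onu).
  rewrite (parseval _ _ frame_orthonormal).
  by apply: eq_bigr => k _; rewrite !mxE.
have /eqP := congr1 determinant PPt.
rewrite det_mulmx det_tr det1 -expr2 sqrf_eq1 => /orP[/eqP//|/eqP detPN].
by rewrite detPN oppr_gt0 ltNge ler01 in detP.
Qed.

(** Changing the frame multiplies the matrix by an orthogonal one of
    determinant 1. *)
Lemma volume_frame u x1 x2 x3 x4 : posonb u ->
  volume e x1 x2 x3 x4 = volume u x1 x2 x3 x4.
Proof.
move=> pu; rewrite /volume -[LHS]mulr1 -(change_of_frame_det pu) -[X in _ * X]det_tr.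
rewrite -det_mulmx; congr (\det _); apply/matrixP => i j; rewrite !mxE.
by rewrite (parseval _ _ frame_orthonormal); apply: eq_bigr => k _; rewrite !mxE.
Qed.

Lemma volumeE u x1 x2 x3 x4 : volume u x1 x2 x3 x4 =
  det4 (fun a c => g [:: x1; x2; x3; x4]`_a u`_c).
Proof. exact: det_mx44. Qed.

Lemma volume_linear3 u x1 x2 x4 : scalar (fun x => volume u x1 x2 x x4).
Proof.
move=> a x y; rewrite !volumeE /det4 /det3 /bump /= !linearPl /=.
ring.
Qed.

Lemma volume_skew u x1 x2 x3 x4 : volume u x1 x2 x3 x4 = - volume u x1 x2 x4 x3.
Proof. by rewrite !volumeE /det4 /det3 /bump /=; ring. Qed.

Lemma volume_linear4 u x1 x2 x3 : scalar (volume u x1 x2 x3).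
Proof.
move=> a x y; rewrite ![volume u x1 x2 x3 _]volume_skew volume_linear3.
by rewrite opprD mulrN.
Qed.

(** The Levi-Civita symbol is the volume form on the frame; expanding [x] and
    [y] counts each unordered pair of indices twice, which cancels the 1/2. *)
Lemma hodge_wedge x y (i j : 'I_4) :
  hodge (wedge x y) i j = volume e e`_i e`_j x y.
Proof.
have lcE (p q : 'I_4) : levi_civita i j p q = volume e e`_i e`_j e`_p e`_q.
  congr (\det _); apply/matrixP => a c; rewrite !mxE (tnth_nth i).
  by case: a => [[|[|[|[|//]]]] ?] //=; rewrite (inner_frame _ _ frame_orthonormal).
have volE z w : volume e e`_i e`_j z w =
    \sum_(p < 4) \sum_(q < 4) volume e e`_i e`_j e`_p e`_q * (g z e`_p * g w e`_q).
  rewrite (scalar_expansion z frame_orthonormal (volume_linear3 _ _ _ w)).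
  apply: eq_bigr => p _.
  rewrite (scalar_expansion w frame_orthonormal (@volume_linear4 _ _ _ _)).
  by rewrite mulr_sumr; apply: eq_bigr => q _; rewrite mulrA mulrC.
rewrite mxE; under eq_bigr do under eq_bigr do rewrite lcE mxE mulrBr.
under eq_bigr do rewrite sumrB.
rewrite sumrB -!volE [volume _ _ _ y x]volume_skew opprK.
by field.
Qed.

End Duality.

(** * Bivectors spanning the spaces of definite duality *)

Section DualityBasis.
Context {R : realType} {T : oriented_euclidean4 R}.
Local Notation g := (inner T).
Local Notation e := (@frame R T).
Implicit Types (x y z w : T) (u v : 4.-tuple T).

Lemma contraction_linear (K : 'I_4 -> 'I_4 -> 'I_4 -> 'I_4 -> R) :
  linear (fun b : 'M[R]_4 => \matrix_(i < 4, j < 4)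
    (2^-1 * \sum_(p < 4) \sum_(q < 4) K i j p q * b p q)).
Proof.
move=> a b c; apply/matrixP => i j; rewrite !mxE [a * (_ * _)]mulrCA -mulrDr.
congr (_ * _); rewrite mulr_sumr -big_split /=; apply: eq_bigr => p _.
rewrite mulr_sumr -big_split /=; apply: eq_bigr => q _.
by rewrite !mxE mulrDr mulrCA.
Qed.

Lemma hodge_linear : linear (@hodge R).
Proof. exact: contraction_linear. Qed.

HB.instance Definition _ :=
  GRing.isLinear.Build R 'M[R]_4 'M[R]_4 _ (@hodge R) hodge_linear.

Lemma weyl_op_linear (Rm : T -> T -> T -> T -> R) : linear (weyl_op Rm).
Proof. exact: contraction_linear. Qed.

HB.instance Definition _ (Rm : T -> T -> T -> T -> R) :=
  GRing.isLinear.Build R 'M[R]_4 'M[R]_4 _ (weyl_op Rm) (weyl_op_linear Rm).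

(** Quadruples [(k, l, m, n)] that are even permutations of [(0, 1, 2, 3)], one
    for each plane and its orthogonal complement, with the orientations used in
    the duality bases. *)
Definition even4 : seq (nat * nat * nat * nat) :=
  [:: (0, 1, 2, 3); (2, 3, 0, 1); (0, 2, 3, 1);
      (3, 1, 0, 2); (0, 3, 1, 2); (1, 2, 0, 3)]%N.

(** With the volume form written in [u] itself, two rows of its determinant are
    unit vectors, and what is left is a 2 x 2 minor. *)
Lemma hodge_wedge_frame u (k l m n : nat) : posonb u -> (k, l, m, n) \in even4 ->
  hodge (wedge u`_k u`_l) = wedge u`_m u`_n.
Proof.
move=> pu klmn; have onu := posonb_orthonormal pu.
apply/matrixP => i j; rewrite hodge_wedge (volume_frame _ _ _ _ pu) volumeE mxE.
move: klmn; rewrite !inE !xpair_eqE /det4 /det3 /=.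
by do ![case/orP]; do ![case/andP]; do 4!move/eqP->;
  rewrite /bump /= !(orthonormalP_nth onu) ?size_tuple //=
          ![g e`_i _]innerC ![g e`_j _]innerC; ring.
Qed.

Lemma wedgeC x y : wedge y x = - wedge x y.
Proof. by apply/matrixP => i j; rewrite !mxE; ring. Qed.

Lemma sum_delta n (f : 'I_n -> R) j : \sum_(i < n) (i == j)%:R * f i = f j.
Proof.
rewrite (bigD1 j) //= eqxx mul1r big1 ?addr0 // => i ij.
by rewrite (negPf ij) mul0r.
Qed.

Lemma wedge_expansion (b : 'M[R]_4) : b^T = - b ->
  b = 2^-1 *: \sum_(k < 4) \sum_(l < 4) b k l *: wedge e`_k e`_l.
Proof.
move=> /matrixP bT; apply/matrixP => i j; rewrite mxE summxE.
transitivity (2^-1 * \sum_(k < 4) \sum_(l < 4)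
    ((k == i)%:R * ((l == j)%:R * b k l) - (k == j)%:R * ((l == i)%:R * b k l))).
  under eq_bigr do rewrite sumrB -!mulr_sumr !sum_delta.
  rewrite sumrB !sum_delta; have := bT i j; rewrite !mxE => ->; by field.
congr (_ * _); apply: eq_bigr => k _; rewrite summxE; apply: eq_bigr => l _.
by rewrite !mxE !(inner_frame _ _ frame_orthonormal); ring.
Qed.

Lemma duality_basis_Lambda (eps : R) u : posonb u -> eps * eps = 1 ->
  {subset duality_basis eps u <= Lambda eps}.
Proof.
move=> pu eps2 b bu; apply/mem_Lambda.
have {bu} [k [l [m [n [kl mn ->]]]]] : exists k l m n,
    [/\ (k, l, m, n) \in even4, (m, n, k, l) \in even4 &
     b = wedge u`_k u`_l + eps *: wedge u`_m u`_n].
  move: bu; rewrite !inE => /or3P[] /eqP->;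
    [exists 0%N, 1%N, 2%N, 3%N | exists 0%N, 2%N, 3%N, 1%N
     | exists 0%N, 3%N, 1%N, 2%N]; split=> //.
split; first by apply/matrixP => i j; rewrite !mxE; ring.
rewrite addrC hodge_linear (hodge_wedge_frame pu kl) (hodge_wedge_frame pu mn).
by rewrite scalerDr scalerA eps2 scale1r addrC.
Qed.

(** If [hodge b = eps *: b] then [b = (b + eps *: hodge b) / 2], and the map
    [b |-> b + eps *: hodge b] sends each wedge product of two frame vectors to
    zero or to a multiple of a member of the duality basis. *)
Lemma dim_Lambda (eps : R) : eps * eps = 1 -> (\dim (Lambda eps : {vspace 'M[R]_4}) <= 3)%N.
Proof.
move=> eps2; apply: leq_trans (dim_span (duality_basis eps e)).
apply: dimvS; apply/subvP => b /mem_Lambda[bT hb].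
pose V := <<duality_basis eps e>>%VS.
have wV k l m n : (k, l, m, n) \in even4 ->
    wedge e`_k e`_l + eps *: wedge e`_m e`_n \in V.
  have XV b' : b' \in duality_basis eps e -> b' \in V by apply: memv_span.
  have epsX b' c : c + eps *: b' = eps *: (b' + eps *: c).
    by rewrite scalerDr scalerA eps2 scale1r addrC.
  have {XV} [X0 X1 X2] :
    [/\ wedge e`_0 e`_1 + eps *: wedge e`_2 e`_3 \in V,
        wedge e`_0 e`_2 + eps *: wedge e`_3 e`_1 \in V
      & wedge e`_0 e`_3 + eps *: wedge e`_1 e`_2 \in V].
    by split; apply: XV; rewrite !inE eqxx ?orbT.
  rewrite !inE !xpair_eqE /=; do ![case/orP]; do ![case/andP]; do 4!move/eqP->;
    by [|rewrite epsX memvZ].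
have FV (k l : 'I_4) : wedge e`_k e`_l + eps *: hodge (wedge e`_k e`_l) \in V.
  have h m n : (k : nat, l : nat, m, n) \in even4 ->
      wedge e`_k e`_l + eps *: hodge (wedge e`_k e`_l) \in V.
    by move=> kl; rewrite (hodge_wedge_frame frameP kl) wV.
  have h' m n : (l : nat, k : nat, m, n) \in even4 ->
      wedge e`_k e`_l + eps *: hodge (wedge e`_k e`_l) \in V.
    move=> lk; rewrite wedgeC [hodge _]linearN scalerN -opprD rpredN /=.
    by rewrite (hodge_wedge_frame frameP lk) wV.
  have [kl|kl] := eqVneq k l.
    rewrite kl; have -> : wedge e`_l e`_l = 0 by apply/matrixP => i j; rewrite !mxE subrr.
    by rewrite linear0 scaler0 addr0 mem0v.
  case: k l kl h h' => [[|[|[|[|//]]]] ?] [[|[|[|[|//]]]] ?] //= _ h h';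
    solve [exact: (h 0 1)%N | exact: (h 2 3)%N | exact: (h 0 2)%N | exact: (h 3 1)%N
      | exact: (h 0 3)%N | exact: (h 1 2)%N | exact: (h' 0 1)%N | exact: (h' 2 3)%N
      | exact: (h' 0 2)%N | exact: (h' 3 1)%N | exact: (h' 0 3)%N | exact: (h' 1 2)%N].
have -> : b = 2^-1 *: (b + eps *: hodge b).
  by rewrite hb scalerA eps2 scale1r -mulr2n -scaler_nat scalerA mulVf ?pnatr_eq0 ?scale1r.
rewrite {1}(wedge_expansion bT) {2}(wedge_expansion bT) linearZ /= scalerA mulrC -scalerA.
rewrite -scalerDr !memvZ //= linear_sum scaler_sumr -big_split memv_suml // => k _.
rewrite linear_sum scaler_sumr -big_split memv_suml // => l _.
by rewrite linearZ /= scalerA mulrC -scalerA -scalerDr memvZ.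
Qed.

End DualityBasis.

(** * The Weyl tensor in an orthonormal frame *)

Section Weyl.
Context {R : realType} {T : oriented_euclidean4 R}.
Local Notation g := (inner T).
Local Notation e := (@frame R T).
Implicit Types (x y z w : T) (u v : 4.-tuple T) (B : T -> T -> R).

(** The coordinate matrix of a bilinear form, so that equations between
    matrices in the chosen frame become equations between forms, which can be
    tested in any frame. *)
Definition bivector B : 'M[R]_4 := \matrix_(i < 4, j < 4) B e`_i e`_j.

Lemma bivectorP u B C : orthonormal g u -> bilinear_form B -> bilinear_form C ->
  bivector B = bivector C <-> forall i j : 'I_4, B u`_i u`_j = C u`_i u`_j.
Proof.
move=> onu bB bC; split=> [BC i j|BC].
  apply: (bilinear_eq frame_orthonormal bB bC) => k l.
  by have /matrixP/(_ k l) := BC; rewrite !mxE.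
by apply/matrixP => i j; rewrite !mxE (bilinear_eq onu bB bC).
Qed.

(** The plane and the complementary plane, both oriented, that make up the
    [c]-th member of a duality basis. *)
Definition planes (c : nat) : nat * nat * nat * nat :=
  nth (0, 0, 0, 0)%N [:: (0, 1, 2, 3); (0, 2, 3, 1); (0, 3, 1, 2)]%N c.

(** The components, in the frame [u], of the [c]-th member of
    [duality_basis eps u]. *)
Definition omega (eps : R) (c i j : nat) : R :=
  let: (k, l, m, n) := planes c in
  (k == i)%:R * (l == j)%:R - (l == i)%:R * (k == j)%:R
  + eps * ((m == i)%:R * (n == j)%:R - (n == i)%:R * (m == j)%:R).

(** The pairing of a skew array with [omega eps c], where each unordered pair of
    indices counts once. *)
Definition contract (eps : R) (c : nat) (f : nat -> nat -> R) : R :=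
  let: (k, l, m, n) := planes c in f k l + eps * f m n.

(** The frame-free form of [omega]: the same bivector as a bilinear form. *)
Definition omega_form eps u c z w : R :=
  let: (k, l, m, n) := planes c in
  g u`_k z * g u`_l w - g u`_l z * g u`_k w
  + eps * (g u`_m z * g u`_n w - g u`_n z * g u`_m w).

Lemma omega_form_bilinear eps u c : bilinear_form (omega_form eps u c).
Proof.
rewrite /omega_form; case: (planes c) => [[[k l] m] n].
by split=> [z a x y|z a x y]; rewrite !linearPr /=; ring.
Qed.

Lemma omega_formE eps u (c : 'I_3) (i j : 'I_4) : orthonormal g u ->
  omega_form eps u c u`_i u`_j = omega eps c i j.
Proof.
move=> onu; rewrite /omega_form /omega.
by case: c => [[|[|[|//]]] ?]; rewrite /= !(orthonormalP_nth onu) ?size_tuple.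
Qed.

Lemma duality_basisE eps u (c : 'I_3) :
  (duality_basis eps u)`_c = bivector (omega_form eps u c).
Proof.
by apply/matrixP => i j; rewrite mxE; case: c => [[|[|[|//]]] ?] /=; rewrite !mxE.
Qed.

Lemma duality_basisP (eps : R) u : posonb u -> eps * eps = 1 ->
  basis_of (Lambda eps) (duality_basis eps u).
Proof.
move=> pu eps2; rewrite basisEfree size_tuple dim_Lambda //.
have -> : (<<duality_basis eps u>> <= Lambda eps)%VS.
  by apply/span_subvP => b /(duality_basis_Lambda pu eps2).
rewrite !andbT /=; have onu := posonb_orthonormal pu.
apply/freeP => k k0.
pose B z w := \sum_(c < 3) k c * omega_form eps u c z w.
have bB : bilinear_form B.
  split=> [z a x y|z a x y]; rewrite /B mulr_sumr -big_split /=; apply: eq_bigr => c _.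
    by rewrite (proj1 (omega_form_bilinear _ _ _)); ring.
  by rewrite (proj2 (omega_form_bilinear _ _ _)); ring.
have b0 : bilinear_form (fun _ _ : T => 0 : R) by split=> [z a x y|z a x y]; ring.
have {k0} : bivector B = bivector (fun _ _ => 0).
  apply/matrixP => i j; move/matrixP/(_ i j): k0; rewrite [in X in X -> _]summxE.
  rewrite [in X in X -> _]mxE !mxE => <-; apply: eq_bigr => c _; rewrite duality_basisE.
  by rewrite mxE mxE.
move/(bivectorP onu bB b0) => B0 c.
have {B0} B0 i j : \sum_(c < 3) k c * omega eps c (i : 'I_4) (j : 'I_4) = 0.
  by rewrite -[RHS](B0 i j); apply: eq_bigr => c' _; rewrite omega_formE.
have := B0 0 (inord c.+1); rewrite (bigD1 c) //= big1 => [|c' c'c].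
  rewrite addr0 inordK; last by rewrite ltnS.
  by case: c {B0} => [[|[|[|//]]] ?]; rewrite /omega /= !(mulr0, mulr1, mul0r, subr0, addr0).
rewrite inordK; last by rewrite ltnS.
move: c'c; rewrite /omega -val_eqE.
by case: c c' {B0} => [[|[|[|//]]] ?] [[|[|[|//]]] ?] //= _;
  rewrite !(mulr0, mulr1, mul0r, subr0, addr0).
Qed.

Section Tensor.
Variables (Rm : T -> T -> T -> T -> R) (cRm : curvature_tensor Rm).
Local Notation W := (weyl Rm).

Lemma ricci_bilinear : bilinear_form (ricci Rm).
Proof.
split=> [y a x z|y a x z]; rewrite /ricci mulr_sumr -big_split /=; apply: eq_bigr => k _.
  by rewrite (curv_linear1 cRm).
by rewrite (curv_linear3 cRm).
Qed.

Lemma ricciC x y : ricci Rm x y = ricci Rm y x.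
Proof. by apply: eq_bigr => k _; rewrite (curv_pairs cRm). Qed.

Lemma weyl_curvature : curvature_tensor W.
Proof.
have [rl rr] := ricci_bilinear.
split; rewrite /weyl.
- by move=> y z w a x x'; rewrite (curv_linear1 cRm) !linearPl /= !rl; ring.
- by move=> x z w a y y'; rewrite (curv_linear2 cRm) !linearPl /= !rl; ring.
- by move=> x y w a z z'; rewrite (curv_linear3 cRm) !linearPr /= !rr; ring.
- by move=> x y z a w w'; rewrite (curv_linear4 cRm) !linearPr /= !rr; ring.
- by move=> x y z w; rewrite (curv_skew12 cRm); ring.
- by move=> x y z w; rewrite (curv_skew34 cRm); ring.
- move=> x y z w; rewrite (curv_pairs cRm) [g x z]innerC [g y w]innerC [g x w]innerC
   [g y z]innerC [ricci _ y w]ricciC [ricci _ x z]ricciC [ricci _ y z]ricciC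
   [ricci _ x w]ricciC; ring.
- move=> x y z w; rewrite -[RHS](curv_bianchi cRm x y z w).
  rewrite [g y x]innerC [g z y]innerC [g z x]innerC.
  rewrite [ricci _ y x]ricciC [ricci _ z y]ricciC [ricci _ z x]ricciC; ring.
Qed.

Lemma weyl_op_wedge x y : weyl_op Rm (wedge x y) = bivector (fun z w => W z w x y).
Proof.
have cW := weyl_curvature.
apply/matrixP => i j; rewrite !mxE.
have WE z w : W e`_i e`_j z w =
    \sum_(p < 4) \sum_(q < 4) W e`_i e`_j e`_p e`_q * (g z e`_p * g w e`_q).
  rewrite (scalar_expansion z frame_orthonormal (curv_linear3 cW _ _ w)).
  apply: eq_bigr => p _.
  rewrite (scalar_expansion w frame_orthonormal (curv_linear4 cW _ _ _)).
  by rewrite mulr_sumr; apply: eq_bigr => q _; rewrite mulrA mulrC.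
under eq_bigr do under eq_bigr do rewrite mxE mulrBr.
under eq_bigr do rewrite sumrB.
rewrite sumrB -!WE [W _ _ y x](curv_skew34 cW) opprK.
by field.
Qed.

(** Both sides of each eigenvector equation are coordinate matrices of bilinear
    forms, so they may be compared in the frame [u] instead of the chosen one. *)
Lemma weyl_diagP (eps : R) u (a : seq R) : posonb u -> eps * eps = 1 ->
  weyl_diag eps Rm u a <->
  forall (c : 'I_3) (i j : 'I_4),
    contract eps c (fun k l => W u`_i u`_j u`_k u`_l) = a`_c * omega eps c i j.
Proof.
move=> pu eps2; have onu := posonb_orthonormal pu; have cW := weyl_curvature.
pose D c z w := contract eps c (fun k l => W z w u`_k u`_l).
have DE (c : 'I_3) : weyl_op Rm (duality_basis eps u)`_c = bivector (D c).
  by case: c => [[|[|[|//]]] ?]; rewrite linearD linearZ /= !weyl_op_wedge;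
    apply/matrixP => i j; rewrite !mxE.
have bD c : bilinear_form (D c).
  rewrite /D /contract; case: (planes c) => [[[k l] m] n].
  split=> [z b x y|z b x y]; first by rewrite !(curv_linear1 cW); ring.
  by rewrite !(curv_linear2 cW); ring.
have bO (c : 'I_3) : bilinear_form (fun z w => a`_c * omega_form eps u c z w).
  have [ol or] := omega_form_bilinear eps u c.
  by split=> [z b x y|z b x y]; rewrite ?ol ?or; ring.
have EE (c : 'I_3) : a`_c *: (duality_basis eps u)`_c =
    bivector (fun z w => a`_c * omega_form eps u c z w).
  by rewrite duality_basisE; apply/matrixP => i j; rewrite !mxE.
split=> [[_ Wa] c i j|Wa]; last split; first 1 last.
- exact: duality_basisP.
- move=> c; rewrite DE EE; apply/(bivectorP onu (bD c) (bO c)) => i j.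
  by rewrite omega_formE // -Wa.
have := Wa c; rewrite DE EE => /(bivectorP onu (bD c) (bO c))/(_ i j).
by rewrite omega_formE.
Qed.

End Tensor.
End Weyl.

(** * Skew arrays of size four *)

Section SkewForms.
Context {R : realType}.
Implicit Types f h : nat -> nat -> R.

Definition skew_form f := forall p q, f p q = - f q p.

(** The six arrays [omega 1 c], [omega (-1) c] form an orthogonal basis of the
    skew arrays, each of pairing 2 with itself. *)
Lemma skew_split f (i j : 'I_4) : skew_form f ->
  f i j = 2^-1 * \sum_(c < 3) (contract 1 c f * omega 1 c i j
                             + contract (-1) c f * omega (-1) c i j).
Proof.
move=> sf; have f0 k : f k k = 0 by have := sf k k; lra.
rewrite !big_ord_recl big_ord0 /contract /omega /=.
have sf' := sf i j; move: sf'.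
case: i j => [[|[|[|[|//]]]] ?] [[|[|[|[|//]]]] ?] /= sf';
  rewrite !(mul0r, mulr0, mulr1, subr0, sub0r, addr0, add0r, oppr0) ?f0.
all: lra.
Qed.

Lemma contract_omega eps eps' (c d : 'I_3) :
  contract eps c (omega eps' d) = (c == d)%:R * (1 + eps * eps') :> R.
Proof.
case: c d => [[|[|[|//]]] ?] [[|[|[|//]]] ?]; rewrite /contract /omega /=.
all: rewrite !(mul0r, mulr0, mulr1, subr0, sub0r, addr0, add0r, oppr0).
all: lra.
Qed.

Lemma skew_parseval f h : skew_form f -> skew_form h ->
  \sum_(p < 4) \sum_(q < 4) f p q * h p q =
  \sum_(c < 3) (contract 1 c f * contract 1 c h
              + contract (-1) c f * contract (-1) c h).
Proof.
move=> sf sh; have f0 k : f k k = 0 by have := sf k k; lra.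
rewrite !big_ord_recl !big_ord0 /contract /= /bump /= !f0.
rewrite !(sf 1 0)%N !(sf 2 0)%N !(sf 3 0)%N !(sf 2 1)%N !(sf 3 1)%N !(sf 3 2)%N.
rewrite !(sh 1 0)%N !(sh 2 0)%N !(sh 3 0)%N !(sh 2 1)%N !(sh 3 1)%N !(sh 3 2)%N.
ring.
Qed.
End SkewForms.

(** * The matrix of the anti-self-dual Weyl operator *)

Section WeylMinus.
Context {R : realType} {T : oriented_euclidean4 R}.
Implicit Types (x y z w : T) (u v : 4.-tuple T).
Implicit Types f h : nat -> nat -> R.

Lemma eq_contract eps (c : 'I_3) f h :
  (forall i j : 'I_4, f i j = h i j) -> contract eps c f = contract eps c h.
Proof.
move=> fh; have fhn i j : (i < 4)%N -> (j < 4)%N -> f i j = h i j.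
  by move=> i4 j4; rewrite -(inordK i4) -(inordK j4).
by case: c => [[|[|[|//]]] ?]; rewrite /contract /= !fhn.
Qed.

Lemma contractZ eps c a f : contract eps c (fun i j => a * f i j) = a * contract eps c f.
Proof. by rewrite /contract; case: planes => [[[k l] m] n]; ring. Qed.

Lemma contract_exchange eps eps' c d (K : nat -> nat -> nat -> nat -> R) :
  contract eps c (fun i j => contract eps' d (K i j)) =
  contract eps' d (fun p q => contract eps c (fun i j => K i j p q)).
Proof.
rewrite /contract; case: (planes c) (planes d) => [[[k l] m] n] [[[k' l'] m'] n'].
ring.
Qed.

Variables (Rm : T -> T -> T -> T -> R) (cRm : curvature_tensor Rm).
Variables (u : 4.-tuple T) (pu : posonb u).
Let cW := weyl_curvature cRm.

Definition weyl_frame (i j k l : nat) : R := weyl Rm u`_i u`_j u`_k u`_l.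

(** The matrix of W^- in [duality_basis (-1) u]; the factor 1/2 compensates the
    square length 2 of the members of that basis. *)
Definition weyl_minus (c d : nat) : R :=
  2^-1 * contract (-1) c (fun i j => contract (-1) d (weyl_frame i j)).

Lemma weyl_frame_pairs i j k l : weyl_frame i j k l = weyl_frame k l i j.
Proof. exact: curv_pairs. Qed.

Lemma skew_weyl_frame i j : skew_form (weyl_frame i j).
Proof. by move=> k l; rewrite /weyl_frame (curv_skew34 cW). Qed.

Lemma weyl_minus_sym c d : weyl_minus c d = weyl_minus d c.
Proof.
rewrite /weyl_minus contract_exchange /contract; congr (_ * _).
by case: (planes c) (planes d) => [[[k l] m] n] [[[k' l'] m'] n'];
  rewrite ![weyl_frame k _ _ _]weyl_frame_pairs ![weyl_frame m _ _ _]weyl_frame_pairs.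
Qed.

Lemma skew_contract_weyl eps d : skew_form (fun i j => contract eps d (weyl_frame i j)).
Proof.
move=> i j; rewrite /contract /weyl_frame; case: planes => [[[k l] m] n].
by rewrite ![weyl _ u`_i _ _ _](curv_skew12 cW); ring.
Qed.

Lemma weyl_diagP_frame (eps : R) (a : seq R) : eps * eps = 1 ->
  weyl_diag eps Rm u a <->
  forall (c : 'I_3) (i j : 'I_4),
    contract eps c (weyl_frame i j) = a`_c * omega eps c i j.
Proof. exact: weyl_diagP. Qed.

(** The two sides differ by four times the sum W_1234 + W_1342 + W_1423, which
    vanishes by the Bianchi identity. *)
Lemma weyl_trace : \sum_(c < 3) contract 1 c (fun i j => contract 1 c (weyl_frame i j))
   = \sum_(c < 3) contract (-1) c (fun i j => contract (-1) c (weyl_frame i j)).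
Proof.
rewrite !big_ord_recl !big_ord0 /contract /=.
have B := curv_bianchi cW u`_1 u`_2 u`_0 u`_3.
have E3 : weyl Rm u`_0 u`_2 u`_3 u`_1 = weyl Rm u`_2 u`_0 u`_1 u`_3.
  by rewrite (curv_skew12 cW) (curv_skew34 cW) opprK.
have E2 : weyl Rm u`_0 u`_3 u`_1 u`_2 = weyl Rm u`_1 u`_2 u`_0 u`_3.
  by rewrite (curv_pairs cW).
have P := weyl_frame_pairs.
rewrite (P 2 3 0 1)%N (P 3 1 0 2)%N (P 1 2 0 3)%N /weyl_frame E3 E2.
lra.
Qed.

Variables (a : seq R) (wp : weyl_diag 1 Rm u a).

(** Since W^+ is diagonal, the symmetry of W in its two pairs of indices leaves no
    self-dual part in the image of an anti-self-dual bivector. *)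
Lemma weyl_minusE (d : 'I_3) (i j : 'I_4) : contract (-1) d (weyl_frame i j) =
  \sum_(c < 3) weyl_minus c d * omega (-1) c i j.
Proof.
move/(weyl_diagP_frame _ (mulr1 1)): wp => wpE.
rewrite (skew_split _ _ (skew_contract_weyl (-1) d)) mulr_sumr.
apply: eq_bigr => c _; rewrite contract_exchange.
rewrite (@eq_contract _ _ _ (fun p q => a`_c * omega 1 c p q)) => [|p q].
  by rewrite contractZ contract_omega /weyl_minus; ring.
rewrite -wpE; apply: eq_contract => k l; exact: weyl_frame_pairs.
Qed.

Lemma weyl_minus_trace : \sum_(c < 3) weyl_minus c c = \sum_(c < 3) a`_c.
Proof.
move/(weyl_diagP_frame _ (mulr1 1)): wp => wpE.
rewrite -mulr_sumr -weyl_trace mulr_sumr; apply: eq_bigr => c _.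
rewrite (@eq_contract _ _ _ (fun p q => a`_c * omega 1 c p q)) => [|p q].
  by rewrite contractZ contract_omega eqxx /=; field.
by rewrite wpE.
Qed.

End WeylMinus.

(** * The contracted square of a curvature tensor *)

Section WeaklyEinstein.
Context {R : realType} {T : oriented_euclidean4 R}.
Local Notation g := (inner T).
Implicit Types (x y z w : T) (u v : 4.-tuple T).
Variables (Rm : T -> T -> T -> T -> R) (cRm : curvature_tensor Rm).

Definition curv_square u x y : R := \sum_(k < 4) \sum_(p < 4) \sum_(q < 4)
  Rm x u`_k u`_p u`_q * Rm y u`_k u`_p u`_q.

(** The frame is changed in one contracted index at a time. *)
Lemma curv_square_frame u v x y : orthonormal g u -> orthonormal g v ->
  curv_square u x y = curv_square v x y.
Proof.
move=> onu onv; rewrite /curv_square.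
transitivity (\sum_(k < 4) \sum_(p < 4) \sum_(q < 4)
    Rm x u`_k u`_p v`_q * Rm y u`_k u`_p v`_q).
  apply: eq_bigr => k _; apply: eq_bigr => p _.
  apply: (contraction_frame (B := fun z w => Rm x _ _ z * Rm y _ _ w)) => //.
  by split=> [z a w w'|z a w w']; rewrite (curv_linear4 cRm); ring.
transitivity (\sum_(k < 4) \sum_(p < 4) \sum_(q < 4)
    Rm x u`_k v`_p v`_q * Rm y u`_k v`_p v`_q).
  apply: eq_bigr => k _; rewrite exchange_big [RHS]exchange_big /=.
  apply: eq_bigr => q _.
  apply: (contraction_frame (B := fun z w => Rm x _ z _ * Rm y _ w _)) => //.
  by split=> [z a w w'|z a w w']; rewrite (curv_linear3 cRm); ring.
rewrite exchange_big [RHS]exchange_big /=; apply: eq_bigr => p _.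
rewrite exchange_big [RHS]exchange_big /=; apply: eq_bigr => q _.
apply: (contraction_frame (B := fun z w => Rm x z _ _ * Rm y w _ _)) => //.
by split=> [z a w w'|z a w w']; rewrite (curv_linear2 cRm); ring.
Qed.

Lemma curv_square_bilinear u : bilinear_form (curv_square u).
Proof.
split=> [z a x y|z a x y]; rewrite /curv_square mulr_sumr -big_split;
  apply: eq_bigr => k _; rewrite mulr_sumr -big_split;
  apply: eq_bigr => p _; rewrite mulr_sumr -big_split;
  by apply: eq_bigr => q _; rewrite (curv_linear1 cRm) /=; ring.
Qed.

Lemma weakly_einstein_frame u : orthonormal g u -> weakly_einstein Rm <->
  exists c : R, forall i j : 'I_4, curv_square u u`_i u`_j = c * (i == j)%:R.
Proof.
move=> onu; split=> -[c hc]; exists c; [move=> i j|move=> x y].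
  by rewrite (curv_square_frame _ _ onu frame_orthonormal) [LHS]hc inner_frame.
rewrite -/(curv_square frame x y) (curv_square_frame _ _ frame_orthonormal onu).
apply: (bilinear_eq (C := fun x y => c * g x y) onu (curv_square_bilinear u)).
  by split=> [z a x' y'|z a x' y']; rewrite ?linearPl ?linearPr /=; ring.
by move=> i j; rewrite hc inner_frame.
Qed.

Lemma ricci_diag u (mu : seq R) (i j : 'I_4) : orthonormal g u -> einstein_diag Rm u mu ->
  ricci Rm u`_i u`_j = (mu`_i + scal Rm / 4) * (i == j)%:R.
Proof.
move=> onu /(_ i u`_j); rewrite /einstein_tensor inner_frame // => E.
by rewrite -[LHS](subrK (scal Rm * (i == j)%:R / 4)) E; ring.
Qed.

Variables (u : 4.-tuple T) (pu : posonb u) (lambda s : R).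
Hypothesis scal_s : scal Rm = s.
Hypothesis ediag : einstein_diag Rm u [:: - lambda; - lambda; lambda; lambda].
Let onu := posonb_orthonormal pu.

Lemma contract_area eps c (i j : nat) :
  contract eps c (fun p q => (i == p)%:R * (j == q)%:R - (i == q)%:R * (j == p)%:R)
    = omega eps c i j :> R.
Proof.
rewrite /contract /omega; case: planes => [[[k l] m] n].
by rewrite ![i == _]eq_sym ![j == _]eq_sym; ring.
Qed.

(** The sum of the Einstein eigenvalues over a coordinate plane is -2 lambda or
    2 lambda on the two planes making up [omega eps 0], which reverses the
    relative sign of these planes, and zero on the other four planes. *)
Lemma einstein_omega (eps : R) (c : 'I_3) (i j : 'I_4)
    (mu := [:: - lambda; - lambda; lambda; lambda]) :
  2^-1 * (mu`_i + mu`_j) * omega eps c i j = - lambda * ((c == 0)%:R * omega (- eps) c i j).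
Proof.
rewrite /omega /mu; case: c i j => [[|[|[|//]]] ?].
all: move=> [[|[|[|[|//]]]] ?] [[|[|[|[|//]]]] ?] /=.
all: rewrite ?(mul0r, mulr0, mulr1, mul1r, subr0, sub0r, addr0, add0r, oppr0, subrr, addNr) //.
all: by field.
Qed.

(** When the Ricci tensor is diagonal, R and W differ by the elementary skew
    tensor of the two pairs of indices times half the sum of two Einstein
    eigenvalues plus s/12. *)
Lemma contract_curv (eps : R) (c : 'I_3) (i j : 'I_4) :
  contract eps c (fun p q => Rm u`_i u`_j u`_p u`_q) =
    contract eps c (weyl_frame Rm u i j) + s / 12 * omega eps c i j
    - lambda * ((c == 0)%:R * omega (- eps) c i j).
Proof.
pose mu := [:: - lambda; - lambda; lambda; lambda].
pose A (p q : nat) : R := (i == p :> nat)%:R * (j == q :> nat)%:R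
                        - (i == q :> nat)%:R * (j == p :> nat)%:R.
pose k := 2^-1 * (mu`_i + mu`_j) + s / 12.
rewrite (@eq_contract _ _ _ _ (fun p q => weyl_frame Rm u i j p q + k * A p q)) => [|p q].
  have -> : contract eps c (fun p q => weyl_frame Rm u i j p q + k * A p q) =
      contract eps c (weyl_frame Rm u i j) + k * contract eps c A.
    by rewrite /contract; case: planes => [[[? ?] ?] ?]; ring.
  by rewrite contract_area -mulNr -einstein_omega /k; ring.
cbv beta; rewrite /weyl_frame /weyl !(ricci_diag _ _ onu ediag) !inner_frame // -/mu scal_s /k.
rewrite /A !val_eqE.
by field.
Qed.
End WeaklyEinstein.

(** * Weakly Einstein tensors of Kaehler type *)

Section Kaehler.
Context {R : realType} {T : oriented_euclidean4 R}.
Local Notation g := (inner T).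
Implicit Types (x y z w : T) (u v : 4.-tuple T).

(** The symmetric matrix [omega 1 0 *m (omega (-1) c)^T], entry by entry. *)
Definition omega_mul (c i j : nat) : R :=
  \sum_(k < 4) omega 1 0 i k * omega (-1) c j k.

(** Distinct [omega (-1) d] anticommute, each [omega] is orthogonal, and
    [omega 1 0] commutes with every [omega (-1) d]: only the mixed products
    survive outside the scalar part. *)
Lemma omega_square (a : R) (b : nat -> R) (i j : 'I_4)
    (F := fun i k => a * omega 1 0 i k + \sum_(d < 3) b d * omega (-1) d i k) :
  \sum_(k < 4) F i k * F j k =
  (a ^+ 2 + \sum_(d < 3) b d ^+ 2) * (i == j)%:R
  + 2 * a * \sum_(d < 3) b d * omega_mul d i j.
Proof.
rewrite /F /omega_mul !big_ord_recl !big_ord0 /= /bump /=.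
case: i j => [[|[|[|[|//]]]] ?] [[|[|[|[|//]]]] ?]; rewrite /omega /=.
all: ring.
Qed.

Variables (Rm : T -> T -> T -> T -> R) (cRm : curvature_tensor Rm).
Variables (u : 4.-tuple T) (pu : posonb u) (lambda s : R).
Hypothesis scal_s : scal Rm = s.
Hypothesis ediag : einstein_diag Rm u [:: - lambda; - lambda; lambda; lambda].
Hypothesis wplus : weyl_diag 1 Rm u [:: s / 6; - (s / 12); - (s / 12)].
Let onu := posonb_orthonormal pu.

Local Notation D := (weyl_minus Rm u).
(** The anti-self-dual block W^- + s/12 of the curvature operator. *)
Let Dh (c d : nat) : R := D c d + s / 12 * (c == d)%:R.

(** [omega_square] is applied to the six pairings of R. The self-dual one for
    [c = 0] has a = s/4 and the single coefficient b_0 = -lambda, and the other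
    two vanish. The anti-self-dual one for [c = 0] has a = -lambda and the first
    column of [Dh] for b, and the other two have a = 0. In the sum, s/4 and the
    s/12 inside [Dh] add up to s/3. *)
Lemma curv_squareE (i j : 'I_4) : curv_square Rm u u`_i u`_j =
  (s ^+ 2 / 16 + 2 * lambda ^+ 2 + \sum_(c < 3) \sum_(d < 3) Dh c d ^+ 2) * (i == j)%:R
  - 2 * lambda * \sum_(c < 3) (D c 0 + (c == 0)%:R * (s / 3)) * omega_mul c i j.
Proof.
pose F (a : R) (b : nat -> R) (i k : nat) : R :=
  a * omega 1 0 i k + \sum_(d < 3) b d * omega (-1) d i k.
have PE (c : 'I_3) (p k : 'I_4) :
    contract 1 c (fun n m => Rm u`_p u`_k u`_n u`_m) =
    F ((c == 0)%:R * (s / 4)) (fun d => (c == 0)%:R * (d == 0)%:R * - lambda) p k.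
  rewrite (contract_curv pu scal_s ediag).
  rewrite (proj1 (weyl_diagP_frame cRm pu _ (mulr1 1)) wplus) /F.
  rewrite !big_ord_recl !big_ord0; case: c => [[|[|[|//]]] ?] /=; by field.
have ME (c : 'I_3) (p k : 'I_4) :
    contract (-1) c (fun n m => Rm u`_p u`_k u`_n u`_m) =
    F (- lambda * (c == 0)%:R) (Dh^~ c) p k.
  rewrite (contract_curv pu scal_s ediag) opprK (weyl_minusE cRm pu wplus) /F /Dh.
  rewrite !big_ord_recl !big_ord0; case: c => [[|[|[|//]]] ?] /=; ring.
have skR x y : skew_form (fun p q => Rm x y u`_p u`_q).
  by move=> p q; rewrite (curv_skew34 cRm).
transitivity (\sum_(k < 4) \sum_(c < 3) (
    F ((c == 0)%:R * (s / 4)) (fun d => (c == 0)%:R * (d == 0)%:R * - lambda) i k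
  * F ((c == 0)%:R * (s / 4)) (fun d => (c == 0)%:R * (d == 0)%:R * - lambda) j k
  + F (- lambda * (c == 0)%:R) (Dh^~ c) i k * F (- lambda * (c == 0)%:R) (Dh^~ c) j k)).
  apply: eq_bigr => k _; rewrite (skew_parseval (skR _ _) (skR _ _)).
  by apply: eq_bigr => c _; rewrite !PE !ME.
rewrite exchange_big /=; under eq_bigr do rewrite big_split /= !omega_square.
rewrite !big_ord_recl !big_ord0 /Dh /=.
by field.
Qed.

(** Enough entries to separate the three matrices [omega_mul c] from each other
    and from the identity. *)
Lemma omega_mulE : [/\ omega_mul 0 0 0 = 1, omega_mul 1 0 0 = 0, omega_mul 2 0 0 = 0 &
  [/\ omega_mul 0 2 2 = -1, omega_mul 1 2 2 = 0 & omega_mul 2 2 2 = 0]] /\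
  [/\ omega_mul 0 0 3 = 0, omega_mul 1 0 3 = -1 & omega_mul 2 0 3 = 0] /\
  [/\ omega_mul 0 0 2 = 0, omega_mul 1 0 2 = 0 & omega_mul 2 0 2 = 1].
Proof. by do !split; rewrite /omega_mul !big_ord_recl big_ord0 /omega /=; ring. Qed.

(** By [curv_squareE], since the matrices [omega_mul c] are traceless and linearly
    independent. *)
Lemma weakly_einstein_kaehlerP : weakly_einstein Rm <->
  forall c : 'I_3, lambda * (D c 0 + (c == 0)%:R * (s / 3)) = 0.
Proof.
split=> [/(weakly_einstein_frame cRm onu)[k kE]|l0]; last first.
  apply/(weakly_einstein_frame cRm onu); eexists => i j.
  rewrite curv_squareE [X in _ - X](_ : _ = 0) ?subr0 //.
  by rewrite mulr_sumr big1 // => c _; rewrite -mulrA [lambda * _]mulrA l0 mul0r mulr0.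
have [[q000 q100 q200 [q022 q122 q222]] [[q003 q103 q203] [q002 q102 q202]]] := omega_mulE.
have [K E] : exists K, forall i j, (i < 4)%N -> (j < 4)%N ->
    K * (i == j)%:R - 2 * lambda * ((D 0 0 + s / 3) * omega_mul 0 i j +
      (D 1 0 * omega_mul 1 i j + D 2 0 * omega_mul 2 i j)) = k * (i == j)%:R.
  exists (s ^+ 2 / 16 + 2 * lambda ^+ 2 + \sum_(c < 3) \sum_(d < 3) Dh c d ^+ 2).
  move=> i j i4 j4; have := kE (Ordinal i4) (Ordinal j4).
  rewrite curv_squareE -!val_eqE /= => <-; congr (_ - _ * _).
  by rewrite !big_ord_recl big_ord0 /= /bump /= !mul0r !addr0 mul1r.
have := E 2 2 isT isT; have := E 0 2 isT isT; have := E 0 3 isT isT; have := E 0 0 isT isT.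
rewrite q000 q100 q200 q022 q122 q222 q003 q103 q203 q002 q102 q202 /= => E00 E03 E02 E22.
case=> [[|[|[|//]]] ?]; rewrite /= ?mul0r ?addr0 ?mul1r; lra.
Qed.
End Kaehler.

(** * Weyl components and Weyl eigenvalues *)

Section Components.
Context {R : realType} {T : oriented_euclidean4 R}.
Variables (Rm : T -> T -> T -> T -> R) (cRm : curvature_tensor Rm).
Variables (u : 4.-tuple T) (pu : posonb u).
Local Notation W := (weyl_frame Rm u).

Lemma weyl_minus_diagP (a b : seq R) : weyl_diag 1 Rm u a ->
  weyl_diag (-1) Rm u b <->
  forall c d : 'I_3, weyl_minus Rm u c d = b`_d * (c == d)%:R.
Proof.
move=> wp; have N1 : (-1) * (-1) = 1 :> R by rewrite mulrNN mulr1.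
split=> [/(weyl_diagP_frame cRm pu _ N1) wm c d|Db].
  rewrite /weyl_minus (@eq_contract _ _ _ _ (fun i j => b`_d * omega (-1) d i j)) //.
  by rewrite contractZ contract_omega mulrNN mulr1; field.
apply/(weyl_diagP_frame cRm pu _ N1) => d i j; rewrite (weyl_minusE cRm pu wp).
rewrite (bigD1 d) //= big1 => [|c cd]; first by rewrite Db eqxx mulr1 addr0.
by rewrite Db (negPf cd) mulr0 mul0r.
Qed.

(** A skew array is determined by its pairings, so the eigenvector equations only
    have to be tested against the two duality bases. *)
Lemma weyl_double_contract (eps : R) (a : seq R) : eps ^+ 2 = 1 ->
  (forall c d : 'I_3,
     contract eps c (fun i j => contract eps d (W i j)) = 2 * a`_d * (c == d)%:R) ->
  (forall c d : 'I_3, contract (- eps) c (fun i j => contract eps d (W i j)) = 0) ->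
  weyl_diag eps Rm u a.
Proof.
rewrite expr2 => eps2 He HN; apply/(weyl_diagP_frame cRm pu a eps2) => d i j.
rewrite (skew_split _ _ (skew_contract_weyl cRm u eps d)).
transitivity (2^-1 * \sum_(c < 3) (2 * a`_d * (c == d)%:R) * omega eps c i j).
  congr (_ * _); apply: eq_bigr => c _.
  have /orP[/eqP E|/eqP E] : (eps == 1) || (eps == -1) by rewrite -sqrf_eq1 expr2 eps2.
    by rewrite E in He HN *; rewrite He HN mul0r addr0.
  by rewrite E opprK in He HN *; rewrite He HN mul0r add0r.
rewrite (bigD1 d) //= big1 => [|c cd]; last by rewrite (negPf cd) mulr0 mul0r.
by rewrite eqxx /=; field.
Qed.

(** Whether [(i, j)] spans one of the two planes of [planes c]. *)
Definition in_plane (c i j : nat) : bool :=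
  let: (k, l, m, n) := planes c in
  (i, j) \in [:: (k, l); (l, k); (m, n); (n, m)].

Definition listed : seq (nat * nat * nat * nat) :=
    [:: (0, 1, 0, 1); (0, 2, 0, 2); (0, 3, 0, 3);
        (2, 3, 2, 3); (1, 3, 1, 3); (1, 2, 1, 2);
        (0, 1, 2, 3); (0, 2, 3, 1); (0, 3, 1, 2)]%N.

(** The listed components and those related to them are exactly the ones whose
    two pairs of indices belong to the same pair of complementary planes. *)
Lemma listedP (i j k l : 'I_4) :
  has (fun m => alg_related m (i : nat, j : nat, k : nat, l : nat)) listed =
  [exists c : 'I_3, in_plane c i j && in_plane c k l].
Proof.
have E : all (fun i => all (fun j => all (fun k => all (fun l =>
     has (fun m => alg_related m (i, j, k, l)) listed ==
     has (fun c => in_plane c i j && in_plane c k l) (iota 0 3))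
   (iota 0 4)) (iota 0 4)) (iota 0 4)) (iota 0 4) by vm_compute.
have I (m : 'I_4) : (m : nat) \in iota 0 4 by rewrite mem_iota ltn_ord.
have /eqP-> := allP (allP (allP (allP E i (I i)) j (I j)) k (I k)) l (I l).
apply/hasP/existsP => -[c]; last by exists (val c); rewrite // mem_iota ltn_ord.
by rewrite mem_iota => c3; exists (Ordinal c3).
Qed.

Lemma omega_plane eps (c i j : nat) : ~~ in_plane c i j -> omega eps c i j = 0 :> R.
Proof.
rewrite /in_plane /omega; case: planes => [[[k l] m] n].
rewrite !inE !xpair_eqE !negb_or ![i == _]eq_sym ![j == _]eq_sym -!natrM !mulnb.
rewrite [(l == i) && _]andbC.
case/and4P=> /negPf-> /negPf-> /negPf-> /negPf->; ring.
Qed.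

Lemma weyl_table (a b : seq R) (i j p q : 'I_4) :
  weyl_diag 1 Rm u a -> weyl_diag (-1) Rm u b ->
  W i j p q = 2^-1 * \sum_(c < 3) (a`_c * omega 1 c i j * omega 1 c p q
                                 + b`_c * omega (-1) c i j * omega (-1) c p q).
Proof.
have N1 : (-1) * (-1) = 1 :> R by rewrite mulrNN mulr1.
move=> /(weyl_diagP_frame cRm pu _ (mulr1 1)) wp /(weyl_diagP_frame cRm pu _ N1) wm.
rewrite (skew_split p q (skew_weyl_frame cRm u i j)).
by congr (_ * _); apply: eq_bigr => c _; rewrite wp wm.
Qed.

(** From the eigenvalues to the components, [weyl_table] gives every component, and
    its terms vanish unless both pairs of indices lie in the same pair of
    planes. In the other direction, [weyl_double_contract] only involves
    components with indices in the six coordinate planes. *)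
Lemma weyl_componentsP (s xi : R) :
  weyl_pm_spectrum Rm u s xi <-> weyl_components Rm u s xi.
Proof.
split=> [[wp wm]|[diag1 diag2 mixed zero]].
  have WE (i j p q : nat) : (i < 4)%N -> (j < 4)%N -> (p < 4)%N -> (q < 4)%N ->
      weyl Rm u`_i u`_j u`_p u`_q = 2^-1 * \sum_(c < 3) (
        [:: s / 6; - (s / 12); - (s / 12)]`_c * omega 1 c i j * omega 1 c p q
      + [:: - (s / 3); 2 * xi - s / 12; - (2 * xi) + 5 * s / 12]`_c
          * omega (-1) c i j * omega (-1) c p q).
    move=> i4 j4 p4 q4.
    exact: (weyl_table (Ordinal i4) (Ordinal j4) (Ordinal p4) (Ordinal q4) wp wm).
  split; last first.
    move=> i j k l unlisted.
    have /existsPn unl : ~~ [exists c : 'I_3, in_plane c i j && in_plane c k l].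
      by rewrite -listedP.
    rewrite [LHS](WE _ _ _ _ (ltn_ord i) (ltn_ord j) (ltn_ord k) (ltn_ord l)).
    rewrite big1 ?mulr0 // => c _.
    have /nandP[/omega_plane z|/omega_plane z] := unl c; rewrite !z; ring.
  1-3: rewrite /= !WE // !big_ord_recl !big_ord0 /omega /=.
  1-3: by congr (_, _, _); field.
have {}zero i j k l : (i < 4)%N -> (j < 4)%N -> (k < 4)%N -> (l < 4)%N ->
    ~~ has (fun m => alg_related m (i, j, k, l)) listed -> W i j k l = 0.
  move=> i4 j4 k4 l4; exact: (zero (Ordinal i4) (Ordinal j4) (Ordinal k4) (Ordinal l4)).
have offdiag eps' eps (c d : 'I_3) : c != d ->
    contract eps' c (fun i j => contract eps d (W i j)) = 0.
  case: c d => [[|[|[|//]]] ?] [[|[|[|//]]] ?] //= _;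
    by rewrite /contract /= !zero // !(mulr0, addr0).
case: diag1 diag2 mixed; rewrite /weyl_comp => a0 a1 a2 [b0 b1 b2] [m0 m1 m2].
have cW := weyl_curvature cRm; have P := weyl_frame_pairs cRm u.
have {}b1 : weyl Rm u`_3 u`_1 u`_3 u`_1 = xi - s / 12.
  by rewrite (curv_skew12 cW) (curv_skew34 cW) opprK.
split; (apply: weyl_double_contract; first by rewrite ?sqrrN expr1n) => c d;
  (have [<-|cd] := eqVneq c d; last by rewrite offdiag // mulr0);
  case: c => [[|[|[|//]]] ?]; rewrite /contract /= ?(P 2 3 0 1)%N ?(P 3 1 0 2)%N ?(P 1 2 0 3)%N
    /weyl_frame ?a0 ?a1 ?a2 ?b0 ?b1 ?b2 ?m0 ?m1 ?m2; by field.
Qed.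

End Components.

(** * Swapping two planes and rotating one *)

Section FrameChange.
Context {R : realType} {T : oriented_euclidean4 R}.
Local Notation g := (inner T).
Implicit Types (x y z w : T) (u v : 4.-tuple T).

Lemma orthonormal_gram v :
  (forall i j : 'I_4, g v`_i v`_j = (i == j)%:R) -> orthonormal g v.
Proof.
case: v => [[|a [|b [|c [|d []]]]] //= sz] G.
have E i j : (i < 4)%N -> (j < 4)%N -> g [:: a; b; c; d]`_i [:: a; b; c; d]`_j = (i == j)%:R.
  by move=> i4 j4; exact: (G (Ordinal i4) (Ordinal j4)).
rewrite /orthonormal /= (E 0 0)%N // (E 1 1)%N // (E 2 2)%N // (E 3 3)%N //.
by rewrite (E 0 1)%N // (E 0 2)%N // (E 0 3)%N // (E 1 2)%N // (E 1 3)%N // (E 2 3)%N // !eqxx.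
Qed.

Lemma posonb_change u v (A : 'M[R]_4) : posonb u ->
  (forall i : 'I_4, v`_i = \sum_(j < 4) A i j *: u`_j) ->
  A *m A^T = 1%:M -> \det A = 1 -> posonb v.
Proof.
move=> pu vE AAt detA; have onu := posonb_orthonormal pu.
have [_ detu] := andP pu; apply/andP; split.
  apply: orthonormal_gram => i j; have /matrixP/(_ i j) := AAt; rewrite !mxE => <-.
  rewrite (parseval _ _ onu); apply: eq_bigr => k _.
  by rewrite mxE !vE !inner_combination.
rewrite (_ : \matrix_(i, j) _ = A *m \matrix_(i < 4, j < 4) coord (orient T) j u`_i).
  by rewrite det_mulmx detA mul1r.
apply/matrixP => i j; rewrite !mxE vE linear_sum; apply: eq_bigr => k _.
by rewrite !mxE linearZ.
Qed.

Lemma posonb_change_nat u v (a : nat -> nat -> R) : posonb u ->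
  (forall i : 'I_4, v`_i = \sum_(j < 4) a i j *: u`_j) ->
  (forall i j : 'I_4, \sum_(k < 4) a i k * a j k = (i == j)%:R) ->
  det4 a = 1 -> posonb v.
Proof.
move=> pu vE aat deta; apply: (@posonb_change u v (\matrix_(i < 4, j < 4) a i j)) => //.
- by move=> i; rewrite vE; apply: eq_bigr => j _; rewrite mxE.
- apply/matrixP => i j; rewrite !mxE -aat; apply: eq_bigr => k _.
  by rewrite !mxE.
- by rewrite det_mx44.
Qed.

Definition swap_frame u : 4.-tuple T := [tuple u`_2; u`_3; u`_0; u`_1].

Lemma posonb_swap u : posonb u -> posonb (swap_frame u).
Proof.
move=> pu; pose a (i j : nat) : R := (nth [::]
  [:: [:: 0; 0; 1; 0]; [:: 0; 0; 0; 1]; [:: 1; 0; 0; 0]; [:: 0; 1; 0; 0]] i)`_j.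
apply: (@posonb_change_nat u _ a) => //; rewrite /a.
- by case=> [[|[|[|[|//]]]] ?]; rewrite !big_ord_recl big_ord0 /=
    ?scale0r ?scale1r ?addr0 ?add0r.
- by case=> [[|[|[|[|//]]]] ?]; case=> [[|[|[|[|//]]]] ?]; rewrite !big_ord_recl big_ord0 /=
    ?(mul0r, mulr0, mulr1, addr0, add0r).
- by rewrite /det4 /det3 /=; ring.
Qed.

Definition rotate_frame (c s : R) u : 4.-tuple T :=
  [tuple u`_0; u`_1; c *: u`_2 + s *: u`_3; (- s) *: u`_2 + c *: u`_3].

Lemma posonb_rotate c s u : c ^+ 2 + s ^+ 2 = 1 -> posonb u -> posonb (rotate_frame c s u).
Proof.
move=> cs pu; pose a (i j : nat) : R := (nth [::]
  [:: [:: 1; 0; 0; 0]; [:: 0; 1; 0; 0]; [:: 0; 0; c; s]; [:: 0; 0; - s; c]] i)`_j.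
apply: (@posonb_change_nat u _ a) => //; rewrite /a.
- by case=> [[|[|[|[|//]]]] ?]; rewrite !big_ord_recl big_ord0 /=
    ?scale0r ?scale1r ?addr0 ?add0r.
- case=> [[|[|[|[|//]]]] ?]; case=> [[|[|[|[|//]]]] ?]; rewrite !big_ord_recl big_ord0 /=;
  solve [ring | rewrite -[RHS]cs; ring].
- by rewrite /det4 /det3 /= -[RHS]cs; ring.
Qed.

Lemma duality_basis_swap u : duality_basis 1 (swap_frame u) = 
  [tuple (duality_basis 1 u)`_0; - (duality_basis 1 u)`_1; - (duality_basis 1 u)`_2].
Proof.
by apply: val_inj; congr [:: _; _; _]; apply/matrixP => i j; rewrite !mxE /=; ring.
Qed.

Lemma duality_basis_rotate eps c s u (X := duality_basis eps u) : c ^+ 2 + s ^+ 2 = 1 ->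
  duality_basis eps (rotate_frame c s u) = 
  [tuple X`_0; c *: X`_1 + s *: X`_2; (- s) *: X`_1 + c *: X`_2].
Proof.
move=> cs; apply: val_inj; congr [:: _; _; _]; apply/matrixP => i j.
- rewrite !mxE /= -[in RHS](mul1r (g u`_2 _ * _ - _)) -cs !linearPl !linearZl_LR /=.
  ring.
- by rewrite !mxE /= !linearPl !linearZl_LR /=; ring.
- by rewrite !mxE /= !linearPl !linearZl_LR /=; ring.
Qed.

(** The angle that makes a symmetric 2 x 2 matrix diagonal, with [p] the
    off-diagonal entry and [q] the difference of the diagonal ones. *)
Lemma rotation_exists (p q : R) : exists c s : R,
  c ^+ 2 + s ^+ 2 = 1 /\ (c ^+ 2 - s ^+ 2) * p + c * s * q = 0.
Proof.
have [->|p0] := eqVneq p 0; first by exists 1, 0; split; ring.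
pose d := Num.sqrt (q ^+ 2 + 4 * p ^+ 2).
have d2 : d ^+ 2 = q ^+ 2 + 4 * p ^+ 2.
  by rewrite sqr_sqrtr // addr_ge0 ?sqr_ge0 // mulr_ge0 ?sqr_ge0.
(* With t = s / c, the condition reads p t^2 - q t - p = 0. *)
pose t := (q + d) / (2 * p).
have tE : p * t ^+ 2 - q * t - p = 0.
  have -> : p * t ^+ 2 - q * t - p = (d ^+ 2 - q ^+ 2 - 4 * p ^+ 2) / (4 * p).
    by rewrite /t; field.
  by rewrite d2; field.
have t1 : 0 < 1 + t ^+ 2 by rewrite ltr_pwDl ?sqr_ge0.
pose c := (Num.sqrt (1 + t ^+ 2))^-1.
have c2 : c ^+ 2 * (1 + t ^+ 2) = 1.
  by rewrite exprVn sqr_sqrtr ?ltW // mulVf ?gt_eqF.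
exists c, (c * t); split; first by rewrite -[RHS]c2; ring.
rewrite -[RHS](mulr0 (- c ^+ 2)) -tE; ring.
Qed.

End FrameChange.

(** * Normal frames of Kaehler-type tensors *)

Section NormalForm.
Context {R : realType} {T : oriented_euclidean4 R}.
Local Notation g := (inner T).
Implicit Types (x y z w : T) (u v : 4.-tuple T).
Variables (Rm : T -> T -> T -> T -> R) (cRm : curvature_tensor Rm).

Lemma einstein_tensor_bilinear : bilinear_form (einstein_tensor Rm).
Proof.
have [rl rr] := ricci_bilinear cRm.
by split=> [y a x z|x a y z]; rewrite /einstein_tensor ?rl ?rr ?linearPl ?linearPr /=; ring.
Qed.

(** The trace of the Ricci tensor does not depend on the frame. *)
Lemma einstein_diag_trace u (mu : seq R) : posonb u -> einstein_diag Rm u mu ->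
  \sum_(i < 4) mu`_i = 0.
Proof.
move=> pu ediag; have onu := posonb_orthonormal pu.
have E : scal Rm = \sum_(i < 4) (mu`_i + scal Rm / 4).
  rewrite {1}/scal (contraction_frame frame_orthonormal onu (ricci_bilinear cRm)).
  by apply: eq_bigr => i _; rewrite (ricci_diag _ _ onu ediag) eqxx mulr1.
move: E; rewrite big_split /= sumr_const card_ord; lra.
Qed.

Lemma einstein_diag0 u : posonb u -> einstein_diag Rm u [:: 0; 0; 0; 0] -> einstein Rm.
Proof.
move=> pu ediag; apply: (bilinear_eq (C := fun _ _ => 0) (posonb_orthonormal pu)).
- exact: einstein_tensor_bilinear.
- by split=> [z a x y|z a x y]; ring.
- by move=> i j; rewrite ediag; case: i => [[|[|[|[|//]]]] ?]; rewrite mul0r.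
Qed.

(** The exchange is an even permutation. It fixes the first member of the
    self-dual basis and changes the sign of the other two. *)
Lemma kaehler_swap u (lambda : R) (a b : R) : posonb u ->
  einstein_diag Rm u [:: - lambda; - lambda; lambda; lambda] ->
  weyl_diag 1 Rm u [:: a; b; b] ->
  [/\ posonb (swap_frame u),
      einstein_diag Rm (swap_frame u) [:: lambda; lambda; - lambda; - lambda]
    & weyl_diag 1 Rm (swap_frame u) [:: a; b; b]].
Proof.
move=> pu ediag [_ wp]; split; first exact: posonb_swap.
  by case=> [[|[|[|[|//]]]] ?] y; rewrite /=;
    [exact: (ediag (@Ordinal 4 2 isT)) | exact: (ediag (@Ordinal 4 3 isT))
    | exact: (ediag (@Ordinal 4 0 isT)) | exact: (ediag (@Ordinal 4 1 isT))].
split; first by apply: duality_basisP; rewrite ?mulr1 //; exact: posonb_swap.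
rewrite duality_basis_swap => -[[|[|[|//]]] ?].
- exact: (wp (@Ordinal 3 0 isT)).
- by rewrite /= linearN scalerN; congr (- _); exact: (wp (@Ordinal 3 1 isT)).
- by rewrite /= linearN scalerN; congr (- _); exact: (wp (@Ordinal 3 2 isT)).
Qed.

(** The rotation of the duality bases induced by [rotate_frame]. *)
Definition rotation3 (c s : R) (k l : nat) : R :=
  (nth [::] [:: [:: 1; 0; 0]; [:: 0; c; s]; [:: 0; - s; c]] k)`_l.

Lemma contract_rotate eps c s u (B : T -> T -> R) (v := rotate_frame c s u) (k : 'I_3) :
  c ^+ 2 + s ^+ 2 = 1 -> bilinear_form B -> (forall x y, B x y = - B y x) ->
  contract eps k (fun i j => B v`_i v`_j) =
  \sum_(l < 3) rotation3 c s k l * contract eps l (fun i j => B u`_i u`_j).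
Proof.
move=> cs [Bl Br] Bsk.
have BDl a b x y z : B (a *: x + b *: y) z = a * B x z + b * B y z.
  by rewrite (scalar_lincomb _ _ _ _ (Bl z)).
have BDr a b x y z : B z (a *: x + b *: y) = a * B z x + b * B z y.
  by rewrite (scalar_lincomb _ _ _ _ (Br z)).
have B0 x : B x x = 0 by have := Bsk x x; lra.
rewrite !big_ord_recl big_ord0 /v /rotation3 /contract /rotate_frame.
case: k => [[|[|[|//]]] ?] /=.
- rewrite [in RHS](_ : B u`_2 u`_3 = (c ^+ 2 + s ^+ 2) * B u`_2 u`_3).
    by rewrite !BDl !BDr !B0 [B u`_3 u`_2]Bsk; ring.
  by rewrite cs mul1r.
- rewrite !BDl !BDr [B u`_3 u`_1]Bsk [B u`_2 u`_1]Bsk; ring.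
- rewrite !BDr [B u`_3 u`_1]Bsk; ring.
Qed.

Lemma weyl_minus_rotate c s u (k l : 'I_3) : c ^+ 2 + s ^+ 2 = 1 ->
  weyl_minus Rm (rotate_frame c s u) k l =
  \sum_(i < 3) \sum_(j < 3)
     rotation3 c s k i * rotation3 c s l j * weyl_minus Rm u i j.
Proof.
move=> cs; have cW := weyl_curvature cRm; set v := rotate_frame c s u.
pose H j x y := contract (-1) j (fun p q => weyl Rm x y u`_p u`_q).
have bH j : bilinear_form (H j).
  rewrite /H /contract; case: (planes j) => [[[a b] m] n].
  by split=> [y r x z|y r x z]; rewrite ?(curv_linear1 cW) ?(curv_linear2 cW); ring.
have skH j x y : H j x y = - H j y x.
  rewrite /H /contract; case: (planes j) => [[[a b] m] n].
  by rewrite ![weyl _ x _ _ _](curv_skew12 cW); ring.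
have inner x y : contract (-1) l (fun p q => weyl Rm x y v`_p v`_q) =
    \sum_(j < 3) rotation3 c s l j * H j x y.
  apply: (@contract_rotate (-1) c s u (weyl Rm x y) l) => //.
    by split=> z; [exact: (curv_linear3 cW) | exact: (curv_linear4 cW)].
  exact: (curv_skew34 cW).
rewrite /weyl_minus.
have -> : contract (-1) k (fun p q => contract (-1) l (weyl_frame Rm v p q)) =
    \sum_(j < 3) rotation3 c s l j * contract (-1) k (fun p q => H j v`_p v`_q).
  rewrite (@eq_contract _ _ _ _
    (fun p q => \sum_(j < 3) rotation3 c s l j * H j v`_p v`_q)) => [|p q]; last first.
    exact: inner.
  rewrite !big_ord_recl big_ord0 /contract; case: (planes k) => [[[a b] m] n].
  by rewrite !big_ord_recl !big_ord0; ring.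
rewrite exchange_big mulr_sumr /=; apply: eq_bigr => j _.
rewrite (@contract_rotate (-1) c s u (H j) k) // mulr_sumr mulr_sumr; apply: eq_bigr => i _.
by rewrite /H; ring.
Qed.

(** The rotation mixes only eigenvectors with equal eigenvalues, of the Einstein
    tensor as well as of W^+. *)
Lemma kaehler_rotate c s u (lambda a b : R) : c ^+ 2 + s ^+ 2 = 1 -> posonb u ->
  einstein_diag Rm u [:: - lambda; - lambda; lambda; lambda] ->
  weyl_diag 1 Rm u [:: a; b; b] ->
  [/\ posonb (rotate_frame c s u),
      einstein_diag Rm (rotate_frame c s u) [:: - lambda; - lambda; lambda; lambda]
    & weyl_diag 1 Rm (rotate_frame c s u) [:: a; b; b]].
Proof.
move=> cs pu ediag [_ wp]; split; first exact: posonb_rotate.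
  have [el _] := einstein_tensor_bilinear.
  have e2 := ediag (@Ordinal 4 2 isT); have e3 := ediag (@Ordinal 4 3 isT).
  rewrite /= in e2 e3.
  case=> [[|[|[|[|//]]]] ?] y /=; first exact: (ediag (@Ordinal 4 0 isT)).
  - exact: (ediag (@Ordinal 4 1 isT)).
  - by rewrite (scalar_lincomb _ _ _ _ (el y)) e2 e3 !linearPl !linearZl_LR /=; ring.
  - by rewrite (scalar_lincomb _ _ _ _ (el y)) e2 e3 !linearPl !linearZl_LR /=; ring.
split; first by apply: duality_basisP; rewrite ?mulr1 //; exact: posonb_rotate.
rewrite duality_basis_rotate //; move: (duality_basis 1 u) wp => X wp.
have w1 : weyl_op Rm X`_1 = b *: X`_1 := wp (@Ordinal 3 1 isT).
have w2 : weyl_op Rm X`_2 = b *: X`_2 := wp (@Ordinal 3 2 isT).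
case=> [[|[|[|//]]] ?]; first exact: (wp (@Ordinal 3 0 isT)).
- rewrite /= linearD !linearZ /= w1 w2 scalerDr !scalerA.
  by rewrite [c * b]mulrC [s * b]mulrC.
- rewrite /= linearD !linearZ /= w1 w2 scalerDr !scalerA.
  by rewrite [c * b]mulrC [- s * b]mulrC.
Qed.

(** A negative lambda is turned into a positive one by [kaehler_swap], and
    lambda = 0 would make the tensor Einstein. *)
Lemma kaehler_normal_frame : ~ einstein Rm -> kaehler_type Rm ->
  exists (u : 4.-tuple T) (lambda : R),
  [/\ posonb u, 0 < lambda, einstein_diag Rm u [:: - lambda; - lambda; lambda; lambda]
    & weyl_diag 1 Rm u [:: scal Rm / 6; - (scal Rm / 12); - (scal Rm / 12)]].
Proof.
move=> nE [u [mu1 [mu2 [mu3 [lambda [pu ediag mu12 mu34 wp]]]]]].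
rewrite -mu12 mu34 in ediag.
have := einstein_diag_trace pu ediag; rewrite !big_ord_recl big_ord0 /= => tr.
have {tr} mu1E : mu1 = - lambda by lra.
rewrite {}mu1E in ediag.
have [l0|l0|l0] := ltrgtP 0 lambda; first by exists u, lambda.
  have [pu' ediag' wp'] := kaehler_swap pu ediag wp.
  by exists (swap_frame u), (- lambda); rewrite opprK oppr_gt0.
by case: nE; apply: (einstein_diag0 pu); rewrite -l0 oppr0 in ediag.
Qed.

(** The hypothesis on the first column says that the first member of the
    anti-self-dual basis is an eigenvector; the rest of W^- is a symmetric
    2 x 2 matrix, which a rotation of the last two frame vectors diagonalizes.
    Its last eigenvalue comes from the equality of the traces of W^+ and W^-. *)
Lemma diagonalize_weyl_minus u (lambda a b d : R) : posonb u ->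
  einstein_diag Rm u [:: - lambda; - lambda; lambda; lambda] ->
  weyl_diag 1 Rm u [:: a; b; b] ->
  (forall c : 'I_3, weyl_minus Rm u c 0 = d * (c == 0)%:R) ->
  exists v (t : R),
  [/\ posonb v, einstein_diag Rm v [:: - lambda; - lambda; lambda; lambda],
      weyl_diag 1 Rm v [:: a; b; b] &
      weyl_diag (-1) Rm v [:: d; t; a + b + b - d - t]].
Proof.
move=> pu ediag wp D0; have cW := weyl_curvature cRm.
pose D := weyl_minus Rm u.
have [c [s [cs rot]]] := rotation_exists (D 1 2)%N ((D 2 2)%N - (D 1 1)%N).
have [pv ediagv wpv] := kaehler_rotate cs pu ediag wp.
exists (rotate_frame c s u), (weyl_minus Rm (rotate_frame c s u) 1 1); split=> //.
apply/(weyl_minus_diagP cRm pv _ wpv).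
set D' := weyl_minus Rm (rotate_frame c s u).
have D00 : D 0%N 0%N = d by rewrite -[RHS]mulr1; exact: (D0 (@Ordinal 3 0 isT)).
have D10 : D 1%N 0%N = 0 by rewrite -[RHS](mulr0 d); exact: (D0 (@Ordinal 3 1 isT)).
have D20 : D 2%N 0%N = 0 by rewrite -[RHS](mulr0 d); exact: (D0 (@Ordinal 3 2 isT)).
have Dsym k l : D k l = D l k by apply: weyl_minus_sym.
have D'E (k l : 'I_3) : D' k l = \sum_(i < 3) \sum_(j < 3)
    rotation3 c s k i * rotation3 c s l j * D i j := weyl_minus_rotate u k l cs.
have D'00 : D' 0%N 0%N = d.
  rewrite (D'E (@Ordinal 3 0 isT) (@Ordinal 3 0 isT)) !big_ord_recl !big_ord0 /rotation3 /=.
  by rewrite D00; ring.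
have D'01 : D' 0%N 1%N = 0.
  rewrite (D'E (@Ordinal 3 0 isT) (@Ordinal 3 1 isT)) !big_ord_recl !big_ord0 /rotation3 /=.
  by rewrite (Dsym 0 1)%N (Dsym 0 2)%N D10 D20; ring.
have D'02 : D' 0%N 2%N = 0.
  rewrite (D'E (@Ordinal 3 0 isT) (@Ordinal 3 2 isT)) !big_ord_recl !big_ord0 /rotation3 /=.
  by rewrite (Dsym 0 1)%N (Dsym 0 2)%N D10 D20; ring.
have D'12 : D' 1%N 2%N = 0.
  rewrite (D'E (@Ordinal 3 1 isT) (@Ordinal 3 2 isT)) !big_ord_recl !big_ord0 /rotation3 /=.
  by rewrite (Dsym 2 1)%N -[RHS]rot; ring.
have D'sym k l : D' k l = D' l k by apply: weyl_minus_sym.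
have := weyl_minus_trace cRm pv wpv; rewrite !big_ord_recl !big_ord0 -/D' /= D'00 => tr.
case=> [[|[|[|//]]] ?] [[|[|[|//]]] ?]; rewrite /= ?(mulr0, mulr1) //.
- by rewrite D'sym.
- by rewrite D'sym.
- by rewrite D'sym.
- by move: tr; rewrite /bump /=; lra.
Qed.

End NormalForm.

(** * The classification *)

Theorem corollary1p6 (R : realType) (T : oriented_euclidean4 R) :
  [/\ forall (u : 4.-tuple T) (s lambda xi : R) (Rm : T -> T -> T -> T -> R),
        posonb u ->
        curvature_tensor Rm ->
        scal Rm = s ->
        einstein_diag Rm u [:: - lambda; - lambda; lambda; lambda] ->
        weyl_pm_spectrum Rm u s xi ->
        kaehler_type Rm /\ weakly_einstein Rm,
      forall Rm : T -> T -> T -> T -> R,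
        curvature_tensor Rm ->
        ~ einstein Rm ->
        kaehler_type Rm ->
        weakly_einstein Rm ->
        exists (u : 4.-tuple T) (s xi lambda : R),
          [/\ posonb u, 0 < lambda, scal Rm = s,
              einstein_diag Rm u [:: - lambda; - lambda; lambda; lambda] &
              weyl_pm_spectrum Rm u s xi]
    & forall (u : 4.-tuple T) (s lambda xi : R) (Rm : T -> T -> T -> T -> R),
        posonb u ->
        curvature_tensor Rm ->
        scal Rm = s ->
        einstein_diag Rm u [:: - lambda; - lambda; lambda; lambda] ->
        (weyl_pm_spectrum Rm u s xi <-> weyl_components Rm u s xi)].
Proof.
split=> [u s lambda xi Rm pu cRm scal_s ediag [wp wm]|Rm cRm nE kRm wE
        |u s lambda xi Rm pu cRm _ _]; last exact: weyl_componentsP.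
- split.
    by exists u, (- lambda), (- lambda), lambda, lambda; rewrite scal_s.
  apply/(weakly_einstein_kaehlerP cRm pu scal_s ediag wp) => c.
  rewrite (proj1 (weyl_minus_diagP cRm pu _ wp) wm c (@Ordinal 3 0 isT)) /=.
  by case: c => [[|[|[|//]]] ?] /=; ring.
have [u [lambda [pu l0 ediag wp]]] := kaehler_normal_frame cRm nE kRm.
set s := scal Rm in wp.
have D0 c : weyl_minus Rm u (c : 'I_3) 0 = - (s / 3) * (c == 0)%:R.
  have /eqP := proj1 (weakly_einstein_kaehlerP cRm pu erefl ediag wp) wE c.
  rewrite mulf_eq0 gt_eqF //= addr_eq0 => /eqP->; rewrite -/s; ring.
have [v [t [pv ediagv wpv wmv]]] := diagonalize_weyl_minus cRm pu ediag wp D0.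
(* The second eigenvalue t must be 2 xi - s / 12. *)
exists v, s, ((t + s / 12) / 2), lambda; split=> //; split=> //.
by move: wmv; congr (weyl_diag _ _ _ [:: _; _; _]); field.
Qed.
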